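(* Let $d\geqslant 1$, let $\sigma\in\mathbb R^{d\times d}$ and let $b\in\mathcal C^2(\mathbb R^d,\mathbb R^d)$ have bounded second-order derivatives and be such that there exists $L>0$ with $(x-y)\cdot(b(x)-b(y))\leqslant L|x-y|^2$ for all $x,y\in\mathbb R^d$. Then, for all $p\geqslant 1$ and $t\geqslant 0$, \[\kappa_p^p(t)=\sup_{x,y\in\mathbb R^d,\ x\neq y}\frac{\mathbb E_{(x,y)}\left(|X_t-Y_t|^p\right)}{|x-y|^p},\] where, in the right-hand side, $(X_t,Y_t)_{t\geqslant 0}$ are two solutions of $dX_t=b(X_t)\,dt+\sigma\,dB_t$ driven by the same Brownian motion $B$, with $(X_0,Y_0)=(x,y)$. In particular, for any $t\geqslant 0$, given two solutions $X,Y$ of this SDE driven by the same Brownian motion (with possibly random initial conditions), \[\mathbb E\left(|X_t-Y_t|^p\right)\leqslant \kappa_p^p(t)\,\mathbb E\left(|X_0-Y_0|^p\right).\] As a consequence, for all $p\geqslant 1$ and $t\geqslant 0$, $\beta_p(t)\leqslant\kappa_p(t)$.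
   Context: $|\cdot|$ is the Euclidean norm, $\mathbb S^{d-1}$ the unit sphere of $\mathbb R^d$, and $\nabla b$ the Jacobian matrix of $b$. The matrix $\sigma$ is constant and may be singular, and $B$ is a standard Brownian motion in $\mathbb R^d$, independent of the initial conditions. The SDE is $dX_t=b(X_t)\,dt+\sigma\,dB_t$; $\mathbb E_x$ denotes expectation with $X_0=x$; $\nu P_t$ is the law of $X_t$ when $X_0\sim\nu$. For a solution $X$ of the SDE, $\Phi_t^X$ is the random $d\times d$ matrix such that $\Phi_t^Xv=V_t$ where $(V_s)_{s\geqslant 0}$ solves $dV_t=\nabla b(X_t)V_t\,dt$, $V_0=v$. For $p\geqslant 1$, $t\geqslant 0$, \[\kappa_p(t)=\sup_{x\in\mathbb R^d,\ v\in\mathbb S^{d-1}}\left(\mathbb E_x\left(|\Phi_t^Xv|^p\right)\right)^{1/p},\qquad \kappa_p^p(t)=(\kappa_p(t))^p .\] $\mathcal P_p(\mathbb R^d)$ is the set of probability measures on $\mathbb R^d$ with finite $p$-th moment, $\mathcal W_p$ is the $L^p$ Wasserstein distance associated with the Euclidean distance, and \[\beta_p(t)=\sup_{\nu,\mu\in\mathcal P_p(\mathbb R^d),\ \nu\neq\mu}\frac{\mathcal W_p(\nu P_t,\mu P_t)}{\mathcal W_p(\nu,\mu)}=\sup_{x\neq y}\frac{\mathcal W_p(\delta_xP_t,\delta_yP_t)}{|x-y|}.\] *)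

(* Defs.v *)
From HB Require Import structures.
From mathcomp Require Import all_boot all_order all_algebra.
From mathcomp Require Import all_classical all_reals all_analysis.

Set Implicit Arguments.
Unset Strict Implicit.
Unset Printing Implicit Defensive.

Import Order.TTheory GRing.Theory Num.Theory.
Import numFieldNormedType.Exports.

Local Open Scope classical_set_scope.
Local Open Scope ring_scope.

(* Points of R^d are row vectors, as in the library's differential calculus:
   a matrix M acts on v as v *m M^T, and [jacobian f x] is the transpose of
   the textbook Jacobian matrix, so that v *m jacobian f x is the derivative
   of f at x in the direction v. *)

Section euclidean.
Context {R : realType} {d : nat}.
Implicit Types u v : 'rV[R]_d.

Definition dotp u v : R := \sum_i u 0 i * v 0 i.

(* The library norm `|v| is the sup norm; it only serves for the topology. *)
Definition enorm v : R := Num.sqrt (dotp v v).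

(* ('D_(delta_mx 0 i) (jacobian f) x) j k is the second-order partial
   derivative of the k-th component of f in the directions i and j. *)
Definition C2 (f : 'rV[R]_d -> 'rV[R]_d) : Prop :=
  [/\ forall x, differentiable f x,
      forall x, differentiable (jacobian f) x &
      forall i : 'I_d,
        continuous (fun x => 'D_(delta_mx 0 i) (jacobian f) x)].

Definition bounded_second_derivatives (f : 'rV[R]_d -> 'rV[R]_d) : Prop :=
  exists M : R, forall (i j k : 'I_d) (x : 'rV[R]_d),
    `|('D_(delta_mx 0 i) (jacobian f) x) j k| <= M.

Definition one_sided_lipschitz (f : 'rV[R]_d -> 'rV[R]_d) (L : R) : Prop :=
  forall x y, dotp (x - y) (f x - f y) <= L * enorm (x - y) ^+ 2.

Definition time_integral (f : R -> 'rV[R]_d) (t : R) : 'rV[R]_d :=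
  \row_i (\int[lebesgue_measure]_(s in `[0, t]) f s 0 i)%R.

End euclidean.

Definition borelE (R : realType) (d : nat) :=
  g_sigma_algebraType (@open 'rV[R]_d).

Section processes.
Context {R : realType} {d : nat}.
Context {dO : measure_display} {Omega : measurableType dO}.
Variable P : probability Omega R.
Implicit Types (B X Y : R -> Omega -> 'rV[R]_d).

Definition random_vector (Z : Omega -> 'rV[R]_d) : Prop :=
  measurable_fun setT (Z : Omega -> borelE R d).

Definition independent_classes (G H : set (set Omega)) : Prop :=
  forall E F, G E -> H F -> P (E `&` F) = (P E * P F)%E.

Definition sigma_var (d' : measure_display) (T : measurableType d')
    (Z : Omega -> T) : set (set Omega) :=
  [set E | exists2 A : set T, measurable A & E = Z @^-1` A].

Definition sigma_process B (D : set R) : set (set Omega) :=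
  <<s [set E | exists s, exists A : set (borelE R d),
         [/\ D s, measurable A & E = B s @^-1` A] ]>>.

Definition continuous_path (T : topologicalType) (f : R -> T) : Prop :=
  {within `[0, +oo[, continuous f}.

(* The fourth condition says that B t - B s has law N(0, (t - s) I_d);
   the second parameter of [normal_prob] is the standard deviation. *)
Definition standard_brownian_motion B : Prop :=
  [/\ forall t, 0 <= t -> random_vector (B t),
      {ae P, forall w, B 0 w = 0},
      {ae P, forall w, continuous_path (fun t => B t w)},
      (forall s t, 0 <= s -> s < t -> forall A : 'I_d -> set R,
         (forall i, measurable (A i)) ->
         P [set w | forall i, A i ((B t w - B s w) 0 i)] =
         \big[*%E/1%E]_(i < d) normal_prob 0 (Num.sqrt (t - s)) (A i)) &
      (forall s t, 0 <= s -> s < t ->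
         independent_classes
           (sigma_var ((fun w => B t w - B s w) : Omega -> borelE R d))
           (sigma_process B `[0, s]))].

(* The noise is additive, so the stochastic integral of the constant matrix
   sigma is sigma B_t and the equation is a pathwise integral equation. *)
Definition sde_solution (b : 'rV[R]_d -> 'rV[R]_d) (sigma : 'M[R]_d) B X : Prop :=
  (forall t, 0 <= t -> random_vector (X t)) /\
  {ae P, forall w, continuous_path (fun t => X t w) /\
     forall t, 0 <= t ->
       X t w = X 0 w + time_integral (fun s => b (X s w)) t
               + (B t w - B 0 w) *m sigma^T}.

Definition starts_at X (x : 'rV[R]_d) : Prop := {ae P, forall w, X 0 w = x}.

Definition independent_of_process (d' : measure_display) (T : measurableType d')
    (Z : Omega -> T) B : Prop :=
  independent_classes (sigma_var Z) (sigma_process B `[0, +oo[).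

(* dV_t = nabla b(X_t) V_t dt for V_t = Phi_t v, simultaneously for all v. *)
Definition tangent_process (b : 'rV[R]_d -> 'rV[R]_d) X
    (Phi : R -> Omega -> 'M[R]_d) : Prop :=
  (forall t, 0 <= t -> forall i j, measurable_fun setT (fun w => Phi t w i j)) /\
  {ae P, forall w, forall v : 'rV[R]_d,
     let V := fun t => v *m (Phi t w)^T in
     continuous_path V /\
     forall t, 0 <= t ->
       V t = v + time_integral (fun s => V s *m jacobian b (X s w)) t}.

Definition moment (p : R) (Z : Omega -> 'rV[R]_d) : \bar R :=
  (\int[P]_w (enorm (Z w) `^ p)%:E)%E.

(* Solutions are unique up to null sets, so ranging over all solutions
   started at x amounts to taking the expectation E_x. *)
Definition kappa (b : 'rV[R]_d -> 'rV[R]_d) (sigma : 'M[R]_d) B (p t : R) :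
    \bar R :=
  ereal_sup [set r : \bar R |
    exists x v : 'rV[R]_d, exists X, exists Phi : R -> Omega -> 'M[R]_d,
      [/\ enorm v = 1, sde_solution b sigma B X, starts_at X x,
          tangent_process b X Phi &
          r = (moment p (fun w => v *m (Phi t w)^T) `^ p^-1)%E] ].

Definition coupling_sup (b : 'rV[R]_d -> 'rV[R]_d) (sigma : 'M[R]_d) B
    (p t : R) : \bar R :=
  ereal_sup [set r : \bar R |
    exists x y : 'rV[R]_d, exists X Y,
      [/\ x <> y,
          sde_solution b sigma B X /\ starts_at X x,
          sde_solution b sigma B Y /\ starts_at Y y &
          r = (moment p (fun w => (X t w - Y t w)%R)
               / (enorm (x - y) `^ p)%:E)%E] ].

End processes.

Section wasserstein.
Context {R : realType} {d : nat}.
Implicit Types (nu mu : probability (borelE R d) R).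

Definition finite_moment (p : R) nu : Prop :=
  (\int[nu]_x (enorm (x : 'rV[R]_d) `^ p)%:E < +oo)%E.

Definition coupling nu mu
    (pi : probability (borelE R d * borelE R d)%type R) : Prop :=
  forall A : set (borelE R d), measurable A ->
    pi (A `*` setT) = nu A /\ pi (setT `*` A) = mu A.

Definition wasserstein (p : R) nu mu : \bar R :=
  ((ereal_inf [set r : \bar R |
     exists2 pi : probability (borelE R d * borelE R d)%type R,
       coupling nu mu pi &
       r = \int[pi]_z (enorm ((z.1 : 'rV[R]_d) - (z.2 : 'rV[R]_d)) `^ p)%:E])
   `^ p^-1)%E.

(* nu' is nu P_t, the law of X_t when X_0 has law nu. The probability space is
   existentially quantified because a given one may be too small to carry an
   initial condition of law nu independent of the Brownian motion. *)
Definition law_at (b : 'rV[R]_d -> 'rV[R]_d) (sigma : 'M[R]_d) (t : R)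
    nu nu' : Prop :=
  exists (dO : measure_display) (Omega : measurableType dO)
         (P : probability Omega R) (B X : R -> Omega -> 'rV[R]_d),
    [/\ standard_brownian_motion P B,
        sde_solution P b sigma B X,
        independent_of_process P (X 0 : Omega -> borelE R d) B,
        forall A : set (borelE R d), measurable A -> P (X 0 @^-1` A) = nu A &
        forall A : set (borelE R d), measurable A -> P (X t @^-1` A) = nu' A].

(* Probability measures are total set functions in the library: they are
   distinct as measures when they differ on a measurable set. *)
Definition beta (b : 'rV[R]_d -> 'rV[R]_d) (sigma : 'M[R]_d) (p t : R) :
    \bar R :=
  ereal_sup [set r : \bar R |
    exists nu mu nu' mu' : probability (borelE R d) R,
      [/\ finite_moment p nu /\ finite_moment p mu,
          (exists2 A : set (borelE R d), measurable A & nu A <> mu A),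
          law_at b sigma t nu nu', law_at b sigma t mu mu' &
          r = (wasserstein p nu' mu' / wasserstein p nu mu)%E] ].

End wasserstein.

(* Main.v *)
From HB Require Import structures.
Require Import Defs.
From mathcomp Require Import all_boot all_order all_algebra.
From mathcomp Require Import all_classical all_reals all_analysis.
From mathcomp Require Import measurable_realfun ring lra.

Set Implicit Arguments.
Unset Strict Implicit.
Unset Printing Implicit Defensive.

Import Order.TTheory GRing.Theory Num.Theory.
Import numFieldNormedType.Exports.

Local Open Scope classical_set_scope.
Local Open Scope ring_scope.

(** The noise is additive, so it cancels in the difference of two solutions
driven by the same Brownian motion: for each path of B the equation is an
ordinary differential equation, and the one-sided Lipschitz condition gives a
flow whose increments grow at most like exp (L t) (driven_path_exists,
driven_path_contract). Bounded second derivatives of b make this flow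
differentiable in its starting point, with derivative the tangent process and a
quadratic error term that is uniform in the path of B and in the starting
point (driven_path_differentiable).

The first claim compares finite increments of the flow with its derivative.
In L^p, the increment of the flow from x to x + u is at most
kappa |u| + D |u|^2. When the segment is cut into n equal pieces, Minkowski's
inequality adds n such bounds, and the quadratic terms contribute only
D |u|^2 / n; hence the increment is at most kappa |u| (flow_gap_kappa).
Conversely the derivative in a unit direction is a limit of difference
quotients, so the p-th power of kappa is at most the supremum over pairs of
solutions (kappa_coupling_sup).

For random starting points the flow has to be jointly measurable in the
starting point and in the noise, so it is defined as a limit of Euler schemes,
which are explicit measurable functions (flow, measurable_flow). Every solution
follows this flow almost surely (solution_flow). When the starting points are
independent of B, they can be frozen by Fubini's theorem (integral_freeze), and
the bound for deterministic points applies (coupling_moment).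

For the Wasserstein distance, the law at time t is obtained from the initial
law by a kernel that does not depend on the probability space carrying the
solution: Euler schemes have the same law for all Brownian motions, by
independence of the increments, and so has their limit (flow_law). A coupling
of two initial laws, moved by the flow with one common Brownian motion
independent of it, becomes a coupling of the laws at time t
(transport_coupling), and its cost is multiplied by at most the p-th power of
kappa (transport_cost_le). *)

(** * The Euclidean norm and continuity of paths *)

Section euclidean_norm.
Context {R : realType} {d : nat}.
Implicit Types (u v w : 'rV[R]_d) (a : R).

Lemma dotpC u v : dotp u v = dotp v u.
Proof. by apply: eq_bigr => i _; rewrite mulrC. Qed.

Lemma dotpDl u v w : dotp (u + v) w = dotp u w + dotp v w.
Proof. by rewrite /dotp -big_split; apply: eq_bigr => i _; rewrite mxE mulrDl. Qed.

Lemma dotpDr u v w : dotp u (v + w) = dotp u v + dotp u w.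
Proof. by rewrite dotpC dotpDl !(dotpC u). Qed.

Lemma dotpZl a u v : dotp (a *: u) v = a * dotp u v.
Proof. by rewrite /dotp mulr_sumr; apply: eq_bigr => i _; rewrite mxE mulrA. Qed.

Lemma dotpZr a u v : dotp u (a *: v) = a * dotp u v.
Proof. by rewrite dotpC dotpZl dotpC. Qed.

Lemma dotpBl u v w : dotp (u - v) w = dotp u w - dotp v w.
Proof. by rewrite -scaleN1r dotpDl dotpZl mulN1r. Qed.

Lemma dotpBr u v w : dotp u (v - w) = dotp u v - dotp u w.
Proof. by rewrite dotpC dotpBl !(dotpC u). Qed.

Lemma dotpp_ge0 u : 0 <= dotp u u.
Proof. by apply: sumr_ge0 => i _; rewrite -expr2 sqr_ge0. Qed.

Lemma enorm_ge0 u : 0 <= enorm u.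
Proof. exact: sqrtr_ge0. Qed.

Lemma sqr_enorm u : enorm u ^+ 2 = dotp u u.
Proof. by rewrite sqr_sqrtr// dotpp_ge0. Qed.

Lemma enormZ a u : enorm (a *: u) = `|a| * enorm u.
Proof.
by rewrite /enorm dotpZl dotpZr mulrA -expr2 sqrtrM ?sqr_ge0// sqrtr_sqr.
Qed.

Lemma enormN u : enorm (- u) = enorm u.
Proof. by rewrite -scaleN1r enormZ normrN1 mul1r. Qed.

Lemma enormBC u v : enorm (u - v) = enorm (v - u).
Proof. by rewrite -enormN opprB. Qed.

Lemma enorm0 : enorm (0 : 'rV[R]_d) = 0.
Proof. by rewrite -(scale0r 0) enormZ normr0 mul0r. Qed.

Lemma ler_coord_enorm u i : `|u 0 i| <= enorm u.
Proof.
rewrite -sqrtr_sqr ler_sqrt// ?dotpp_ge0// expr2 /dotp (bigD1 i)//= lerDl.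
by apply: sumr_ge0 => j _; rewrite -expr2 sqr_ge0.
Qed.

Lemma enorm_eq0 u : enorm u = 0 -> u = 0.
Proof.
move=> u0; apply/rowP => i; rewrite mxE; apply/eqP.
by rewrite -normr_le0 -u0 ler_coord_enorm.
Qed.

Lemma enorm_gt0 u : u <> 0 -> 0 < enorm u.
Proof.
by move=> u0; rewrite lt_neqAle enorm_ge0 andbT eq_sym; apply/eqP => /enorm_eq0.
Qed.

Lemma dotp_le u v : dotp u v <= enorm u * enorm v.
Proof.
have [/enorm_eq0 ->|u0] := eqVneq (enorm u) 0.
  by rewrite enorm0 mul0r /dotp big1// => i _; rewrite mxE mul0r.
have [/enorm_eq0 ->|v0] := eqVneq (enorm v) 0.
  by rewrite enorm0 mulr0 /dotp big1// => i _; rewrite mxE mulr0.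
have {}u0 : 0 < enorm u by rewrite lt_neqAle eq_sym u0 enorm_ge0.
have {}v0 : 0 < enorm v by rewrite lt_neqAle eq_sym v0 enorm_ge0.
have := dotpp_ge0 (enorm v *: u - enorm u *: v).
rewrite dotpBl !dotpBr !dotpZl !dotpZr -!sqr_enorm (dotpC v u).
have : 0 < enorm u * enorm v by rewrite mulr_gt0.
nra.
Qed.

Lemma normr_dotp_le u v : `|dotp u v| <= enorm u * enorm v.
Proof.
rewrite ler_norml dotp_le andbT lerNl.
by rewrite -mulN1r -dotpZl scaleN1r (le_trans (dotp_le _ _))// enormN.
Qed.

Lemma ler_enormD u v : enorm (u + v) <= enorm u + enorm v.
Proof.
rewrite -(@ler_pXn2r _ 2)// ?nnegrE ?addr_ge0 ?enorm_ge0//.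
rewrite sqr_enorm dotpDl !dotpDr (dotpC v u) -!sqr_enorm.
have := dotp_le u v; lra.
Qed.

Lemma ler_coord_norm u i : `|u 0 i| <= `|u|.
Proof.
rewrite [leRHS]/Num.norm/= mx_normrE.
exact: (le_bigmax _ (fun ij => `|u ij.1 ij.2|) (0, i)).
Qed.

Lemma ler_norm_coord u (c : R) : 0 <= c -> (forall i, `|u 0 i| <= c) -> `|u| <= c.
Proof.
move=> c0 uc; rewrite [leLHS]/Num.norm/= mx_normrE.
by apply/bigmax_leP; split => // -[i j] _ /=; rewrite ord1.
Qed.

Lemma norm_le_enorm u : `|u| <= enorm u.
Proof. by apply: ler_norm_coord => [|i]; [exact: enorm_ge0|exact: ler_coord_enorm]. Qed.

(** The constant d is not the best one: only the existence of some constant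
matters for the comparison of the two norms. *)
Lemma enorm_le_norm u : enorm u <= d%:R * `|u|.
Proof.
rewrite -(@ler_pXn2r _ 2)// ?nnegrE ?mulr_ge0 ?enorm_ge0//.
rewrite sqr_enorm exprMn.
apply: (@le_trans _ _ (d%:R * `|u| ^+ 2)).
  rewrite mulr_natl -[leRHS](_ : \sum_(i < d) `|u| ^+ 2 = _); last first.
    by rewrite sumr_const card_ord.
  apply: ler_sum => i _.
  by rewrite -expr2 -real_normK ?num_real// ler_pXn2r// ?nnegrE// ler_coord_norm.
rewrite ler_wpM2r ?sqr_ge0// -natrX ler_nat; case: (d) => // n.
by rewrite -mulnn leq_pmulr.
Qed.

(** A crude bound, in which d times the largest entry of M replaces its operator
norm for the sup norm. *)
Lemma norm_mulmx u (M : 'M[R]_d) : `|u *m M| <= d%:R * `|M| * `|u|.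
Proof.
apply: ler_norm_coord => [|j]; first by rewrite !mulr_ge0.
rewrite mxE (le_trans (ler_norm_sum _ _ _))//.
rewrite -mulrA mulr_natl -[leRHS](_ : \sum_(i < d) `|M| * `|u| = _); last first.
  by rewrite sumr_const card_ord.
apply: ler_sum => i _.
rewrite normrM mulrC ler_pM// ?ler_coord_norm//.
rewrite [leRHS]/Num.norm/= mx_normrE.
exact: (le_bigmax _ (fun ij => `|M ij.1 ij.2|) (i, j)).
Qed.

End euclidean_norm.

Section continuity.
Context {R : realType} {d : nat} {T : topologicalType}.
Implicit Types f g : T -> 'rV[R]_d.

Lemma continuous_rowP f : (forall i, continuous (fun t => f t 0 i)) -> continuous f.
Proof.
move=> cf t; apply/cvgrPdist_le => e e0.
have : \forall s \near t, forall i, `|f t 0 i - f s 0 i| <= e.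
  apply: filter_forall => i; have /cvgrPdist_le := cf i t; exact.
apply: filterS => s fs; apply: ler_norm_coord => [|i]; first exact: ltW.
by rewrite !mxE.
Qed.

Lemma continuous_coord f i : continuous f -> continuous (fun t => f t 0 i).
Proof.
by move=> cf t; apply: (@continuous_comp _ _ _ f (fun M : 'rV[R]_d => M 0 i)); [exact: cf|exact: coord_continuous].
Qed.

Lemma continuous_dotp f g : continuous f -> continuous g ->
  continuous (fun t => dotp (f t) (g t)).
Proof.
move=> cf cg; rewrite /dotp => t; apply: cvg_big => [|i _]; first exact: add_continuous.
by apply: cvgM; exact: continuous_coord.
Qed.

End continuity.

(** * Time integrals and the energy estimate *)

Section real_paths.
Context {R : realType}.
Implicit Types (f g G : R -> R) (s t : R).

(** Freezing a path at its initial value before time 0 extends it to a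
continuous path on the whole line, so that no continuity relative to a subset
has to be carried around. *)
Lemma within_halfline_continuous (T : topologicalType) (f : R -> T) :
  {within `[0, +oo[, continuous f} <-> continuous (fun t => f (Num.max 0 t)).
Proof.
split=> [/subspace_continuousP cf t|cf].
  have cmax : Num.max 0 s @[s --> t] --> Num.max 0 t.
    by apply: continuous_max; [exact: cvg_cst|exact: cvg_id].
  have M0 s : [set` `[0, +oo[] (Num.max 0 s) by rewrite /= in_itv/= andbT le_max lexx.
  move=> A /(cf _ (M0 t)) /cmax At.
  exact: (@filterS R (nbhs (t : R)) _ _ _ (fun s H => H (M0 s)) At).
apply/subspace_continuousP => t /=; rewrite in_itv/= andbT => t0.
have := cf t; rewrite /continuous_at (max_r t0).
move=> ct A At; have := ct A At.
apply: (@filterS R (nbhs (t : R))) => s /= + s0.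
by rewrite max_r//; move: s0; rewrite in_itv/= andbT.
Qed.

Lemma derive_le0_le f df t : 0 <= t ->
  (forall s, 0 < s < t -> is_derive s 1 f (df s)) ->
  (forall s, 0 < s < t -> df s <= 0) ->
  {within `[0, t], continuous f} -> f t <= f 0.
Proof.
rewrite le_eqVlt => /predU1P[<-//|t0] fdf df0 cf.
have fdf' s : s \in `]0, t[ -> is_derive s 1 f (df s) by rewrite in_itv => /fdf.
have [c cab E] := MVT t0 fdf' cf.
rewrite -subr_le0 E subr0 mulr_le0_ge0 ?(ltW t0)//.
by apply: df0; rewrite in_itv in cab.
Qed.

Notation mu := (@lebesgue_measure R).
Notation I f t := (\int[mu]_(s in `[0, t]) f s)%R.

Lemma integrable_continuous f t : continuous f ->
  mu.-integrable `[0, t] (EFin \o f).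
Proof.
move=> cf; apply: continuous_compact_integrable; first exact: segment_compact.
exact: continuous_subspaceT.
Qed.

Lemma Rint_le0 f t : t <= 0 -> I f t = 0.
Proof.
rewrite le_eqVlt => /predU1P[->|t0]; first by rewrite set_itv1 Rintegral_set1.
by rewrite set_itv_ge ?Rintegral_set0// bnd_simp -ltNge.
Qed.

Lemma is_derive_Rint f t : continuous f -> 0 < t ->
  is_derive t 1 (fun t => I f t) (f t).
Proof.
move=> cf t0; have tt : t < t + 1 by rewrite ltrDl.
have [dI <-] := continuous_FTC1_closed tt (integrable_continuous (t + 1) cf) t0 (cf t).
by rewrite derive1E; exact: derivableP.
Qed.

Lemma continuous_Rint f : continuous f -> continuous (fun t => I f t).
Proof.
move=> cf.
have -> : (fun t => I f t) = (fun t => I f (Num.max 0 t)).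
  apply/funext => t; have [t0|t0] := leP 0 t; first by [].
  by rewrite Rint_le0 ?(ltW t0)// Rint_le0.
apply/(within_halfline_continuous (fun t => I f t)).
apply: derivable_oy_Rcontinuous_within_itvcy; split.
  by move=> t; rewrite in_itv/= andbT => t0; have [] := is_derive_Rint cf t0.
have := parameterized_integral_continuous ler01 (integrable_continuous 1 cf).
by move=> /(continuous_within_itvP _ ltr01)[].
Qed.

(** The derivatives in t of the two sides are compared, so that the bound g enters
only through a primitive G and need not be integrated. *)
Lemma Rint_norm_le f (g G : R -> R) t : continuous f -> 0 <= t ->
  (forall s, is_derive s 1 G (g s)) ->
  (forall s, 0 < s < t -> `|f s| <= g s) -> `|I f t| <= G t - G 0.
Proof.
move=> cf t0 dG fg; rewrite ler_norml; apply/andP.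
have cG : continuous G.
  by move=> s; apply/differentiable_continuous/derivable1_diffP; have [] := dG s.
have cI := continuous_Rint cf.
have I0 : I f 0 = 0 by rewrite Rint_le0.
split.
- have : (- (fun t => I f t) - G) t <= (- (fun t => I f t) - G) 0.
    apply: (@derive_le0_le _ (fun s => - f s - g s)); first exact: t0.
    + move=> s /andP[s0 _]; apply: is_deriveB; apply: is_deriveN.
      exact: is_derive_Rint.
    + move=> s st; have := fg _ st; rewrite ler_norml => /andP[]; lra.
    + apply: continuous_subspaceT => s.
      by apply: continuousB; [apply: continuousN; exact: cI|exact: cG].
  rewrite !fctE/= I0; lra.
- have : ((fun t => I f t) - G) t <= ((fun t => I f t) - G) 0.
    apply: (@derive_le0_le _ (fun s => f s - g s)); first exact: t0.
    + move=> s /andP[s0 _]; apply: is_deriveB; exact: is_derive_Rint.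
    + move=> s st; have := fg _ st; rewrite ler_norml => /andP[]; lra.
    + apply: continuous_subspaceT => s.
      by apply: continuousB; [exact: cI|exact: cG].
  rewrite !fctE/= I0; lra.
Qed.

Lemma Rint_increment f (c e : R) s t : continuous f -> 0 <= s -> s <= t ->
  (forall r, s <= r <= t -> `|f r - c| <= e) ->
  `|I f t - I f s - (t - s) * c| <= (t - s) * e.
Proof.
move=> cf s0 st fce.
have [||r] := MVT_segment st (f := fun t => I f t) (df := f).
- move=> r; rewrite in_itv/= => /andP[sr _]; apply: is_derive_Rint => //.
  exact: le_lt_trans sr.
- by apply: continuous_subspaceT; exact: continuous_Rint.
rewrite in_itv/= => rst ->.
rewrite (mulrC (f r)) -mulrBr normrM ger0_norm ?subr_ge0//.
by rewrite ler_wpM2l ?subr_ge0// fce.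
Qed.

End real_paths.

Section time_integrals.
Context {R : realType} {d : nat}.
Implicit Types (f g w : R -> 'rV[R]_d) (x c : 'rV[R]_d) (s t : R).

Lemma time_integral_le0 f t : t <= 0 -> time_integral f t = 0.
Proof. by move=> t0; apply/rowP => i; rewrite !mxE Rint_le0. Qed.

Lemma eq_time_integral f g t : (forall s, 0 <= s <= t -> f s = g s) ->
  time_integral f t = time_integral g t.
Proof.
move=> fg; apply/rowP => i; rewrite !mxE; apply: eq_Rintegral => s.
by rewrite inE/= in_itv/= => /fg ->.
Qed.

Lemma time_integralD f g t : continuous f -> continuous g ->
  time_integral (fun s => f s + g s) t = time_integral f t + time_integral g t.
Proof.
move=> cf cg; apply/rowP => i; rewrite !mxE -RintegralD//.
- by apply: eq_Rintegral => s _; rewrite mxE.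
- by apply: integrable_continuous; exact: continuous_coord.
- by apply: integrable_continuous; exact: continuous_coord.
Qed.

Lemma time_integralZ (a : R) f t : continuous f ->
  time_integral (fun s => a *: f s) t = a *: time_integral f t.
Proof.
move=> cf; apply/rowP => i; rewrite !mxE -RintegralZl//.
- by apply: eq_Rintegral => s _; rewrite mxE.
- by apply: integrable_continuous; exact: continuous_coord.
Qed.

Lemma time_integralB f g t : continuous f -> continuous g ->
  time_integral (fun s => f s - g s) t = time_integral f t - time_integral g t.
Proof.
move=> cf cg; rewrite -scaleN1r -time_integralZ// -time_integralD//.
  by apply: eq_time_integral => s _; rewrite scaleN1r.
by move=> s; apply: cvgZl_tmp; exact: cg.
Qed.

Lemma continuous_time_integral f : continuous f -> continuous (time_integral f).
Proof.
move=> cf; apply: continuous_rowP => i.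
under eq_fun do rewrite mxE.
by apply: continuous_Rint; exact: continuous_coord.
Qed.

Lemma time_integral_norm_le f (g G : R -> R) t : continuous f -> 0 <= t ->
  (forall s, is_derive s 1 G (g s)) ->
  (forall s, 0 < s < t -> `|f s| <= g s) -> `|time_integral f t| <= G t - G 0.
Proof.
move=> cf t0 dG fg; apply: ler_norm_coord => [|i].
  rewrite (le_trans (normr_ge0 (\int[lebesgue_measure]_(s in `[0, t]) 0 : R)%R))//.
  apply: Rint_norm_le dG _ => //; first exact: cst_continuous.
  by move=> s st; rewrite normr0 (le_trans _ (fg _ st)).
rewrite mxE; apply: Rint_norm_le dG _ => //; first exact: continuous_coord.
by move=> s st; rewrite (le_trans (ler_coord_norm _ _))// fg.
Qed.

Lemma time_integral_increment f c (e : R) s t : continuous f -> 0 <= s -> s <= t ->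
  (forall r, s <= r <= t -> `|f r - c| <= e) ->
  `|time_integral f t - time_integral f s - (t - s) *: c| <= (t - s) * e.
Proof.
move=> cf s0 st fce; apply: ler_norm_coord => [|i].
  by rewrite mulr_ge0 ?subr_ge0// (le_trans _ (fce t _))// st lexx.
rewrite !mxE; apply: Rint_increment => //; first exact: continuous_coord.
move=> r rst; have := ler_coord_norm (f r - c) i.
by rewrite !mxE => /le_trans; apply; exact: fce.
Qed.

(** Along w = x + time_integral f the derivative of |w|^2 is 2 w . f, so a
one-sided bound on w . f is enough for a Gronwall estimate. This is what makes
the one-sided condition on the drift usable without any global Lipschitz
bound. *)
Lemma energy_gronwall f x (a c t : R) : continuous f -> 0 <= a -> 0 <= c ->
  0 <= t ->
  (forall s, 0 < s < t -> dotp (x + time_integral f s) (f s) <=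
     a * enorm (x + time_integral f s) ^+ 2 + c) ->
  enorm (x + time_integral f t) ^+ 2 <=
    expR (2 * a * t) * (enorm x ^+ 2 + 2 * c * t).
Proof.
move=> cf a0 c0 t0 H; set w := fun s => x + time_integral f s.
have cw : continuous w.
  move=> s; apply: continuousD; first exact: cst_continuous.
  exact: continuous_time_integral.
have dw s : 0 < s -> is_derive s 1 (fun s => dotp (w s) (w s)) (2 * dotp (w s) (f s)).
  move=> s0.
  have dwi i : is_derive s 1 (fun s => w s 0 i) (f s 0 i).
    rewrite -[f s 0 i]add0r /w.
    under eq_fun do rewrite !mxE.
    apply: (@is_deriveD _ _ _ (cst (x 0 i))).
    by apply: is_derive_Rint => //; exact: continuous_coord.
  rewrite /dotp (_ : (fun _ => _) = \sum_(i < d) ((fun s => w s 0 i) * (fun s => w s 0 i))); last first.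
    by apply/funext => r; rewrite fct_sumE.
  apply: is_derive_eq; rewrite mulr_sumr; apply: eq_bigr => i _.
  by rewrite /GRing.scale/=; ring.
pose E s := expR (- (2 * a * s)).
have dE s : is_derive s 1 E (- (2 * a) * E s).
  rewrite /E; apply: is_derive_eq.
  by rewrite /GRing.scale/=; ring.
have cE : continuous E.
  by move=> s; apply/differentiable_continuous/derivable1_diffP; have [] := dE s.
have E1 s : 0 < s -> E s <= 1.
  by move=> s0; rewrite /E -expR0 ler_expR oppr_le0 !mulr_ge0// ltW.
(* The function exp (- 2 a s) |w s|^2 - 2 c s is nonincreasing. *)
have : (E * (fun s => dotp (w s) (w s)) - ( *%R (2 * c))) t <=
       (E * (fun s => dotp (w s) (w s)) - ( *%R (2 * c))) 0.
  apply: (@derive_le0_le _ _ (fun s => E s * (2 * dotp (w s) (f s)) +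
    dotp (w s) (w s) * (- (2 * a) * E s) - 2 * c)); first exact: t0.
  - move=> s /andP[s0 _]; have ? := dw _ s0; have ? := dE s.
    by apply: is_derive_eq; rewrite /GRing.scale/=; ring.
  - move=> s st; have := H _ st; rewrite sqr_enorm -/(w s).
    have s0 : 0 < s by case/andP: st.
    move=> /(ler_wpM2l (expR_ge0 (- (2 * a * s)))); rewrite -/(E s).
    have : 0 <= c * (1 - E s) by rewrite mulr_ge0// subr_ge0 E1.
    move: (dotp _ _) (dotp _ _) (E s) => A B e; clear; lra.
  - apply: continuous_subspaceT => s; apply: continuousB.
      by apply: continuousM; [exact: cE|exact: continuous_dotp].
    exact: mulrl_continuous.
have w0 : w 0 = x by rewrite /w time_integral_le0// addr0.
rewrite !fctE/= mulr0 subr0 w0 /E mulr0 oppr0 expR0 mul1r.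
rewrite -!sqr_enorm -/(w t) lerBlDr => H1.
rewrite -ler_pdivrMl ?expR_gt0// -expRN (le_trans H1)//; lra.
Qed.

End time_integrals.

(** * Ordinary differential equations with one-sided growth *)

Lemma ler_cvg0 (R : realType) (a b : R) (u : nat -> R) :
  u @ \oo --> 0 -> (forall n, a <= b + u n) -> a <= b.
Proof.
move=> u0 abu; have cb : b + u n @[n --> \oo] --> b.
  by rewrite -[X in _ --> X]addr0; apply: cvgD => //; exact: cvg_cst.
rewrite -(cvg_lim _ cb)//; apply: limr_ge; first by apply/cvg_ex; exists b.
exact: nearW.
Qed.

Lemma cvg_geo_half (R : realType) (c : R) : c * 2^-1 ^+ n @[n --> \oo] --> 0.
Proof.
have := @cvg_geometric R c 2^-1; apply.
by rewrite ger0_norm ?invr_ge0// invf_lt1// ltr1n.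
Qed.

(** The limit comes as a witness in a sigma type, so that it can be taken
separately at each time of a sequence of paths. *)
Lemma geometric_cauchy (R : realType) (d : nat) (u : nat -> 'rV[R]_d) (c : R) :
  (forall n, `|u n.+1 - u n| <= c * 2^-1 ^+ n) ->
  {l | forall n, `|l - u n| <= 2 * c * 2^-1 ^+ n}.
Proof.
move=> uc.
have um n k : `|u (n + k)%N - u n| <= 2 * c * (2^-1 ^+ n - 2^-1 ^+ (n + k)).
  elim: k => [|k IH]; first by rewrite addn0 !subrr normr0 mulr0.
  rewrite (le_trans (ler_distD (u (n + k)%N) _ _))//.
  have := uc (n + k)%N; rewrite addnS exprS; move: IH.
  set A := `|_|; set B := `|_|; lra.
have c0 : 0 <= c by have := uc 0%N; rewrite expr0 mulr1; apply: le_trans.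
have um' n m : (n <= m)%N -> `|u n - u m| <= 2 * c * 2^-1 ^+ n.
  move=> /subnK <-; rewrite addnC distrC (le_trans (um _ _))//.
  by rewrite ler_wpM2l ?mulr_ge0// gerBl exprn_ge0// invr_ge0.
have cu : cvgn u.
  apply/cauchy_cvgP/cauchy_exP => e e0.
  have /cvgrPdist_lt/(_ _ e0)[N _ Ne] := cvg_geo_half (2 * c).
  exists (u N); exists N => // m Nm; rewrite -ball_normE/= (le_lt_trans (um' _ _ Nm))//.
  have := Ne N (leqnn N); rewrite sub0r normrN ger0_norm// mulr_ge0// ?mulr_ge0//.
exists (lim (u @ \oo)) => n.
have cun : `|u m - u n| @[m --> \oo] --> `|lim (u @ \oo) - u n|.
  by apply: cvg_norm; apply: cvgB; [exact: cu|exact: cvg_cst].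
rewrite -(cvg_lim _ cun)//; apply: limr_le; first by apply/cvg_ex; eexists; exact: cun.
by exists n => // m nm /=; rewrite distrC um'.
Qed.

Section ode_existence.
Context {R : realType} {d : nat}.
Implicit Types F G : R -> 'rV[R]_d -> 'rV[R]_d.

(** Continuity along paths is all that an integral equation needs, and it is
stable under the cutoffs in time and space made below. *)
Definition continuous_field F :=
  forall (r : R -> R) (y : R -> 'rV[R]_d), continuous r -> continuous y ->
    continuous (fun s => F (r s) (y s)).

Lemma continuous_field_along F (y : R -> 'rV[R]_d) : continuous_field F ->
  continuous y -> continuous (fun s => F s (y s)).
Proof. by move=> cF; apply: (cF id); move=> s; exact: cvg_id. Qed.

(** For negative t the time integral vanishes, so the curve rests at x up to
time 0. *)
Definition integral_curve F (x : 'rV[R]_d) (T : R) (y : R -> 'rV[R]_d) :=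
  continuous y /\ forall t, t <= T -> y t = x + time_integral (fun s => F s (y s)) t.

Lemma time_integral_max (f : R -> 'rV[R]_d) t :
  time_integral f (Num.max 0 t) = time_integral f t.
Proof.
by have [t0|t0] := leP 0 t; [|rewrite !time_integral_le0// ltW].
Qed.

Lemma time_integral_lipschitz (f : R -> 'rV[R]_d) (M : R) s t : continuous f ->
  (forall r, `|f r| <= M) ->
  `|time_integral f t - time_integral f s| <= M * `|t - s|.
Proof.
move=> cf fM; wlog st : s t / s <= t => [H|].
  have [/H//|/ltW/H] := leP s t.
  by rewrite distrC (distrC t).
have M0 : 0 <= M by apply: le_trans (fM 0).
rewrite (ger0_norm (_ : 0 <= t - s)) ?subr_ge0// -time_integral_max -(time_integral_max _ s).
have st' : Num.max 0 s <= Num.max 0 t.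
  by rewrite ge_max le_max lexx/= le_max st orbT.
have := @time_integral_increment R d f 0 M (Num.max 0 s) (Num.max 0 t) cf.
rewrite le_max lexx /= scaler0 subr0 => /(_ isT st')H.
rewrite (le_trans (H _))//; first by move=> r _; rewrite subr0.
rewrite mulrC ler_wpM2l// /Num.max; case: ifPn; case: ifPn; lra.
Qed.

(** Picard iteration. In the weighted norm sup exp (-2Kt) |y t| the integral
operator contracts by the factor 1/2, so the iterates converge on the whole
half-line at once. *)
Lemma picard G (x : 'rV[R]_d) (K M : R) : continuous_field G -> 0 < K ->
  (forall s y z, `|G s y - G s z| <= K * `|y - z|) ->
  (forall s y, `|G s y| <= M) ->
  exists2 y : R -> 'rV[R]_d, continuous y &
    forall t, y t = x + time_integral (fun s => G s (y s)) t.
Proof.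
move=> /(fun H y => @continuous_field_along G y H) cG K0 GK GM.
pose Y n := iter n (fun y t => x + time_integral (fun s => G s (y s)) t) (fun=> x).
have YS n t : Y n.+1 t = x + time_integral (fun s => G s (Y n s)) t by [].
have cY n : continuous (Y n).
  elim: n => [|n IH]; first exact: cst_continuous.
  move=> t; apply: continuousD; first exact: cst_continuous.
  by apply: continuous_time_integral; exact: cG.
have M0 : 0 <= M by apply: le_trans (GM 0 0).
(* A bounds the weighted norm of the first step, which has size at most M t. *)
pose A := M / K.
have A0 : 0 <= A by rewrite divr_ge0// ltW.
pose E (t : R) := expR (2 * K * Num.max 0 t).
have AEh t n : 0 <= A * E t * 2^-1 ^+ n.
  by apply: mulr_ge0; [apply: mulr_ge0 => //; exact: expR_ge0|apply: exprn_ge0; rewrite invr_ge0].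
have dE (a s : R) : is_derive s 1 (fun s => a * expR (2 * K * s)) (2 * K * a * expR (2 * K * s)).
  have ? : is_derive s 1 (fun s => 2 * K * s) (2 * K).
    by apply: is_derive_eq; rewrite /GRing.scale/=; ring.
  by apply: is_derive_eq; rewrite /GRing.scale/=; ring.
have YE n t : `|Y n.+1 t - Y n t| <= A * E t * 2^-1 ^+ n.
  have [t0|t0] := ltP t 0.
    rewrite YS time_integral_le0 ?(ltW t0)//; case: n => [|n]; rewrite ?YS ?time_integral_le0 ?(ltW t0)//.
      by rewrite addr0 subrr normr0 AEh.
    by rewrite subrr normr0 AEh.
  elim: n t t0 => [|n IH] t t0; rewrite /E (max_r t0).
    rewrite YS addrAC subrr add0r expr0 mulr1.
    have H := @time_integral_lipschitz (fun s => G s (Y 0%N s)) M 0 t (cG _ (cY _)) (fun r => GM _ _).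
    move: H; rewrite (time_integral_le0 _ (lexx 0)) !subr0 (ger0_norm t0) => /le_trans; apply.
    rewrite /A -mulrA ler_wpM2l// mulrC ler_pdivlMr//.
    by have := expR_ge1Dx (2 * K * t); have := mulr_ge0 (ltW K0) t0; lra.
  rewrite !YS opprD addrACA subrr add0r -time_integralB; [|exact: cG|exact: cG].
  have H : `|time_integral (fun s => G s (Y n.+1 s) - G s (Y n s)) t| <=
      A * 2^-1 ^+ n.+1 * expR (2 * K * t) - A * 2^-1 ^+ n.+1 * expR (2 * K * 0).
    apply: (@time_integral_norm_le _ _ _ (fun s => 2 * K * (A * 2^-1 ^+ n.+1) * expR (2 * K * s))
      (fun s => A * 2^-1 ^+ n.+1 * expR (2 * K * s))) => //.
      by move=> s; apply: continuousB; exact: cG.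
    move=> s /andP[s0 _]; rewrite (le_trans (GK _ _ _))//.
    rewrite (le_trans (ler_wpM2l (ltW K0) (IH s (ltW s0))))//.
    by rewrite /E (max_r (ltW s0)) exprS le_eqVlt; apply/orP; left; apply/eqP; field.
  apply: (le_trans H); rewrite mulr0 expR0 mulr1 -mulrA (mulrC (2^-1 ^+ _)) mulrA.
  by rewrite gerBl mulr_ge0// exprn_ge0// invr_ge0.
have Ylim t : {l | forall n, `|l - Y n t| <= 2 * (A * E t) * 2^-1 ^+ n}.
  exact: geometric_cauchy (fun n => YE n t).
pose y t := projT1 (Ylim t).
have yY n t : `|y t - Y n t| <= 2 * (A * E t) * 2^-1 ^+ n by exact: (projT2 (Ylim t)).
have yL s t : `|y t - y s| <= M * `|t - s|.
  apply: (ler_cvg0 (cvg_geo_half (2 * (A * E t) + 2 * (A * E s)))) => n.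
  have Yst : `|Y n.+1 t - Y n.+1 s| <= M * `|t - s|.
    rewrite !YS opprD addrACA subrr add0r.
    by apply: time_integral_lipschitz => //; exact: cG.
  have tri (u v p q : 'rV[R]_d) : `|p - q| <= `|p - u| + `|u - v| + `|q - v|.
    rewrite (le_trans (ler_distD v _ _))// (distrC q) lerD2r.
    exact: ler_distD.
  rewrite (le_trans (tri (Y n.+1 t) (Y n.+1 s) _ _))//.
  rewrite (le_trans (lerD (lerD (yY n.+1 t) Yst) (yY n.+1 s)))// exprS.
  move: (AEh t n) (AEh s n); move: (E t) (E s) (2^-1 ^+ n) `|t - s|.
  clear; move=> Et Es h ts; lra.
have cy : continuous y.
  move=> t; apply/cvgrPdist_le => e e0.
  have [M00|Mp] := leP M 0.
    by near=> s; rewrite (le_trans (yL _ _))// (le_trans _ (ltW e0))// mulr_le0_ge0.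
  near=> s; rewrite (le_trans (yL _ _))//.
  rewrite -ler_pdivlMl//; near: s; apply: cvgr_dist_le; first exact: cvg_id.
  by rewrite mulr_gt0// invr_gt0.
exists y => // t; apply/eqP; rewrite -subr_eq0 -normr_le0.
apply: (ler_cvg0 (cvg_geo_half (3 * (A * E t)))) => n; rewrite add0r.
have -> : y t - (x + time_integral (fun s => G s (y s)) t) =
  (y t - Y n.+1 t) + time_integral (fun s => G s (Y n s) - G s (y s)) t.
  by rewrite time_integralB; [rewrite YS !opprD !addrA addrNK|exact: cG|exact: cG].
rewrite (le_trans (ler_normD _ _))// [leRHS](_ : _ =
  2 * (A * E t) * 2^-1 ^+ n.+1 + 2 * (A * E t) * 2^-1 ^+ n); last by rewrite exprS; field.
rewrite lerD// -time_integral_max.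
have t0 : 0 <= Num.max 0 t by rewrite le_max lexx.
have H : `|time_integral (fun s => G s (Y n s) - G s (y s)) (Num.max 0 t)| <=
    A * 2^-1 ^+ n * expR (2 * K * Num.max 0 t) - A * 2^-1 ^+ n * expR (2 * K * 0).
  apply: (@time_integral_norm_le _ _ _ (fun s => 2 * K * (A * 2^-1 ^+ n) * expR (2 * K * s))
    (fun s => A * 2^-1 ^+ n * expR (2 * K * s))) => //.
    by move=> s; apply: continuousB; exact: cG.
  move=> s /andP[s0 _]; rewrite (le_trans (GK _ _ _))//.
  rewrite distrC (le_trans (ler_wpM2l (ltW K0) (yY n s)))//.
  by rewrite /E (max_r (ltW s0)) le_eqVlt; apply/orP; left; apply/eqP; ring.
apply: (le_trans H); rewrite mulr0 expR0 mulr1 -/(E t).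
have : 0 <= A * 2^-1 ^+ n by rewrite mulr_ge0.
move: (AEh t n); move: (E t) (2^-1 ^+ n) (A) => e h a; clear; lra.
Unshelve. all: by end_near. Qed.

Definition locally_lipschitz_field F := forall T m : R, exists2 K : R, 0 < K &
  forall s y z, 0 <= s <= T -> `|y| <= m -> `|z| <= m ->
    `|F s y - F s z| <= K * `|y - z|.

(** On [0, T] both curves stay in a ball, where the field is Lipschitz; the
Gronwall estimate for their difference, which starts at 0, concludes. *)
Lemma integral_curve_unique F x T y z : locally_lipschitz_field F ->
  continuous_field F -> integral_curve F x T y -> integral_curve F x T z ->
  forall t, t <= T -> y t = z t.
Proof.
move=> FL /(fun H y => @continuous_field_along F y H) cF [cy yE] [cz zE] t tT.
have [t0|t0] := ltP t 0.
  by rewrite yE// zE// !time_integral_le0// ltW.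
have bdd (u : R -> 'rV[R]_d) : continuous u -> exists m, forall s, 0 <= s <= T -> `|u s| <= m.
  move=> cu; have cn : {within `[0, T], continuous (fun s => `|u s|)}.
    by apply: continuous_subspaceT => s; apply: cvg_norm; exact: cu.
  have [c _ H] := EVT_max (le_trans t0 tT) cn.
  by exists `|u c| => s sT; apply: H; rewrite in_itv.
have [m1 ym] := bdd _ cy; have [m2 zm] := bdd _ cz.
have [K K0 FK] := FL T (Num.max m1 m2).
have cf : continuous (fun s => F s (y s) - F s (z s)).
  by move=> s; apply: continuousB; exact: cF.
have yz s : s <= T -> y s - z s = 0 + time_integral (fun s => F s (y s) - F s (z s)) s.
  move=> sT; rewrite add0r time_integralB; [|exact: cF|exact: cF].
  by rewrite yE// zE// opprD addrACA subrr add0r.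
have := @energy_gronwall R d _ 0 (d%:R * K) 0 t cf (mulr_ge0 (ler0n _ _) (ltW K0)) (lexx 0) t0.
rewrite -yz// enorm0 expr0n/= mulr0 mul0r addr0 mulr0 => H.
apply/eqP; rewrite -subr_eq0; apply/eqP/enorm_eq0/eqP.
rewrite -sqrf_eq0 eq_le sqr_ge0 andbT; apply: H => s /andP[s0 st].
have sT : s <= T by rewrite (le_trans (ltW st)).
have s0T : 0 <= s <= T by rewrite sT ltW.
rewrite -yz// addr0 (le_trans (dotp_le _ _))// mulrC expr2 mulrA ler_wpM2r ?enorm_ge0//.
rewrite (le_trans (enorm_le_norm _))// -mulrA ler_wpM2l//.
rewrite (le_trans (FK _ _ _ s0T _ _))//.
- by rewrite le_max ym.
- by rewrite le_max zm ?orbT.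
- by rewrite ler_wpM2l ?(ltW K0)// norm_le_enorm.
Qed.

Lemma cutoff_lipschitz (m : R) (y z : 'rV[R]_d) :
  `|Num.min 1 (Num.max 0 (m - `|y|)) - Num.min 1 (Num.max 0 (m - `|z|))|
    <= `|y - z|.
Proof.
have := ler_dist_dist y z; have := normr_ge0 (y - z).
rewrite !ler_norml; move: `|y| `|z| `|y - z| => a b c.
rewrite /Num.min /Num.max => c0 /andP[? ?]; apply/andP.
case: (ltP 0 (m - a)) => ?; case: (ltP 0 (m - b)) => ?;
  case: ltP => ?; case: ltP => ?; split; lra.
Qed.

(** The growth condition gives an a priori bound on solutions up to time T, so the
field may be cut off far away without changing them; after the cutoff it is
bounded and globally Lipschitz, and Picard iteration applies. *)
Lemma integral_curve_upto F (x : 'rV[R]_d) (T : R) : continuous_field F ->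
  locally_lipschitz_field F ->
  (exists2 c : R, 0 <= c & forall (s : R) (y : 'rV[R]_d), 0 <= s <= T ->
     dotp y (F s y) <= c * (1 + enorm y ^+ 2)) ->
  0 <= T -> exists y, integral_curve F x T y.
Proof.
move=> cF FL [c c0 Fc] T0.
(* The squared norm of a solution is at most m - 1, hence its norm is at most m. *)
pose m := 1 + expR (2 * c * T) * (enorm x ^+ 2 + 2 * c * T).
have [K K0 FK] := FL T (m + 1).
pose cl (s : R) := Num.min (Num.max 0 s) T.
have clT s : 0 <= cl s <= T.
  by rewrite /cl le_min le_max lexx T0/= ge_min lexx orbT.
have ccl : continuous cl.
  move=> s; apply: continuous_min; last exact: cvg_cst.
  by apply: continuous_max; [exact: cvg_cst|exact: cvg_id].
have clE s : 0 <= s <= T -> cl s = s.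
  by move=> /andP[s0 sT]; rewrite /cl max_r// min_l.
have m0 : 0 <= m + 1.
  rewrite !addr_ge0// mulr_ge0 ?expR_ge0// addr_ge0 ?sqr_ge0// !mulr_ge0//.
have [N N0 FN] : exists2 N, 0 <= N & forall s y, `|y| <= m + 1 -> `|F (cl s) y| <= N.
  have cF0 : {within `[0, T], continuous (fun s => `|F s 0|)}.
    apply: continuous_subspaceT => s; apply: cvg_norm.
    apply: (@continuous_field_along F (fun=> 0)) => //.
    exact: cst_continuous.
  have [r _ H] := EVT_max T0 cF0.
  exists (`|F r 0| + K * (m + 1)) => [|s y ym].
    by rewrite addr_ge0// mulr_ge0// ltW.
  rewrite -(subrK (F (cl s) 0) (F (cl s) y)) addrC (le_trans (ler_normD _ _))// lerD//.
    by apply: H; rewrite in_itv/=.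
  rewrite (le_trans (FK _ _ _ _ _ _))// ?normr0// subr0.
  by rewrite ler_wpM2l// ltW.
pose chi (y : 'rV[R]_d) := Num.min 1 (Num.max 0 (m + 1 - `|y|)).
have chi01 y : 0 <= chi y <= 1.
  by rewrite /chi le_min ler01 le_max lexx/= ge_min lexx.
have chi0 y : m + 1 < `|y| -> chi y = 0.
  by move=> my; rewrite /chi max_l ?subr_le0 ?ltW// min_r.
have cchi (y : R -> 'rV[R]_d) : continuous y -> continuous (fun s => chi (y s)).
  move=> cy s; apply/cvgrPdist_le => e e0.
  near=> r; apply: (le_trans (cutoff_lipschitz _ _ _)); near: r.
  by apply: cvgr_dist_le => //; exact: cy.
pose G s y := chi y *: F (cl s) y.
have cG : continuous_field G.
  move=> r y cr cy s; apply: cvgZ.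
    exact: cchi.
  apply: (cF (cl \o r)) => // {}s.
  by apply: (@continuous_comp _ _ _ r cl); [exact: cr|exact: ccl].
have GN s y : `|G s y| <= N.
  rewrite /G normrZ; have /andP[h0 h1] := chi01 y; rewrite ger0_norm//.
  have [ym|/chi0 ->] := leP `|y| (m + 1); last by rewrite mul0r.
  by rewrite -[leRHS]mul1r ler_pM// FN.
have GK s y z : `|G s y - G s z| <= (N + K) * `|y - z|.
  wlog ym : y z / `|y| <= m + 1 => [H|].
    have [/H//|ym] := leP `|y| (m + 1).
    have [/H zyH|zm] := leP `|z| (m + 1); first by rewrite distrC (distrC y).
    by rewrite /G !chi0// !scale0r subrr normr0 mulr_ge0// addr_ge0// ltW.
  have -> : G s y - G s z = (chi y - chi z) *: F (cl s) y + chi z *: (F (cl s) y - F (cl s) z).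
    by rewrite scalerBl scalerBr addrA addrNK.
  rewrite (le_trans (ler_normD _ _))// mulrDl lerD// normrZ.
    by rewrite mulrC ler_pM//; [exact: FN|exact: cutoff_lipschitz].
  have /andP[h0 h1] := chi01 z; rewrite ger0_norm//.
  have [zm|/chi0 ->] := leP `|z| (m + 1); last by rewrite mul0r mulr_ge0// ltW.
  by rewrite -[leRHS]mul1r ler_pM//; apply: FK.
have [y cy yE] := picard x cG (ltr_wpDl N0 K0) GK GN.
exists y; split=> // t tT; have [t0|t0] := ltP t 0.
  by rewrite yE !time_integral_le0// ltW.
rewrite yE; congr (_ + _); apply: eq_time_integral => s /andP[s0 st].
have sT : s <= T by exact: le_trans tT.
suff ym : enorm (y s) <= m.
  rewrite /G clE ?s0// (_ : chi _ = 1) ?scale1r// /chi max_r; last first.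
    by rewrite subr_ge0 (le_trans (norm_le_enorm _))// (le_trans ym)// lerDl.
  by rewrite min_l// lerBrDr addrC lerD2r (le_trans (norm_le_enorm _)).
have cf : continuous (fun s => G s (y s)) by exact: continuous_field_along.
have := @energy_gronwall R d _ x c c s cf c0 c0 s0.
rewrite -yE => H.
have {}H : enorm (y s) ^+ 2 <= m - 1.
  rewrite (le_trans (H _))// => [r /andP[r0 rs]|].
    rewrite -yE /G dotpZr; have /andP[h0 h1] := chi01 (y r).
    rewrite -[X in _ <= _ + X]mulr1 -mulrDr (addrC _ 1).
    apply: (le_trans (ler_wpM2l h0 (Fc _ _ (clT r)))).
    by rewrite ler_piMl// mulr_ge0// addr_ge0// sqr_ge0.
  rewrite /m addrAC subrr add0r ler_pM ?expR_ge0//.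
  - by rewrite addr_ge0 ?sqr_ge0// !mulr_ge0.
  - by rewrite ler_expR ler_wpM2l// mulr_ge0.
  - by rewrite lerD2l ler_wpM2l// mulr_ge0.
have := sqr_ge0 (enorm (y s) - 1); move: H; move: (enorm (y s)) (m) => e m'.
clear; nra.
Unshelve. all: by end_near. Qed.

(** The curves on growing time intervals extend each other by uniqueness, and are
glued by reading at time t a curve that lives beyond t. *)
Lemma integral_curve_exists F (x : 'rV[R]_d) : continuous_field F ->
  locally_lipschitz_field F ->
  (forall T, exists2 c : R, 0 <= c & forall (s : R) (y : 'rV[R]_d),
     0 <= s <= T -> dotp y (F s y) <= c * (1 + enorm y ^+ 2)) ->
  exists2 y : R -> 'rV[R]_d, continuous y &
    forall t, y t = x + time_integral (fun s => F s (y s)) t.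
Proof.
move=> cF FL Fc.
have T0 (T : R) : 0 <= Num.max 0 T by rewrite le_max lexx.
have /choice[Y YP] T := integral_curve_upto x cF FL (Fc (Num.max 0 T)) (T0 T).
have YT S T t : t <= S -> S <= T -> Y S t = Y T t.
  move=> tS ST.
  have [cS YS] := YP S; have [cT YT] := YP T.
  have tS' : t <= Num.max 0 S by rewrite le_max tS orbT.
  apply: (integral_curve_unique (x := x) FL cF _ _ tS') => //; split => // s sS.
  by apply: YT; rewrite (le_trans sS)// ge_max le_max lexx/= le_max ST orbT.
pose y t := Y (t + 1) t.
have yY T t : t < T -> y t = Y T t.
  move=> tT; rewrite /y; have [h|h] := leP (t + 1) T.
    by apply: YT => //; rewrite lerDl.
  by apply/esym/YT; exact: ltW.
have cy : continuous y.
  move=> t; have [cY _] := YP (t + 1).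
  have : Y (t + 1) s @[s --> t] --> y t by exact: cY.
  apply: cvg_trans; apply: near_eq_cvg; near=> s.
  by rewrite (@yY (t + 1))//; near: s; apply: lt_nbhsl; rewrite ltrDl.
exists y => // t; have [_ /(_ t)] := YP (t + 1).
rewrite -/(y t) => ->; last by rewrite le_max lerDl ler01 orbT.
congr (_ + _); apply: eq_time_integral => s /andP[_ st].
by rewrite (@yY (t + 1))// (le_lt_trans st)// ltrDl.
Unshelve. all: by end_near. Qed.

End ode_existence.

(** * Regularity of the drift *)

Section line_derivative.
Context {R : realType}.

Lemma is_derive_line (V W : normedModType R) (f : V -> W) (x v : V) (u : R) :
  derivable f (x + u *: v) v ->
  is_derive u 1 (fun u : R => f (x + u *: v)) ('D_v f (x + u *: v)).
Proof.
have E : (fun h : R => h^-1 *: (((fun u : R => f (x + u *: v)) \o shift u) (h *: 1)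
            - f (x + u *: v))) =
    (fun h => h^-1 *: ((f \o shift (x + u *: v)) (h *: v) - f (x + u *: v))).
  apply/funext => h; congr (_ *: (f _ - _)) => /=.
  by rewrite (_ : h%:A = h) ?scalerDl 1?addrCA// /GRing.scale/= mulr1.
by move=> df; apply: DeriveDef; rewrite /derivable/derive E.
Qed.

Lemma is_derive_entry (m n : nat) (M : R -> 'M[R]_(m, n)) (dM : 'M[R]_(m, n)) (u : R) i j :
  is_derive u 1 M dM -> is_derive u 1 (fun u => M u i j) (dM i j).
Proof.
move=> [dMu <-]; apply: DeriveDef; first by move/derivable_mxP : dMu.
by rewrite derive_mx// mxE.
Qed.

Lemma mean_value (f df : R -> R) (c : R) :
  (forall u : R, is_derive u 1 f (df u)) ->
  (forall u, 0 <= u <= 1 -> `|df u| <= c) -> `|f 1 - f 0| <= c.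
Proof.
move=> fdf dfc; have [|u] := @MVT_segment R f df 0 1 ler01 (fun u _ => fdf u).
  apply: continuous_subspaceT => u.
  by apply/differentiable_continuous/derivable1_diffP; have [] := fdf u.
by rewrite in_itv/= => u01 ->; rewrite subr0 mulr1 dfc.
Qed.

End line_derivative.

Section drift_regularity.
Context {R : realType} {d : nat}.
Context (b : 'rV[R]_d -> 'rV[R]_d) (b_C2 : C2 b)
  (b_D2 : bounded_second_derivatives b).

(** The second-order partial derivatives are the entries of the derivatives of
the Jacobian matrix along the basis vectors. *)
Lemma jacobian_lipschitz : exists2 C : R, 0 <= C &
  forall x v, `|jacobian b (x + v) - jacobian b x| <= C * `|v|.
Proof.
have [M bM] := b_D2; have [_ dJ _] := b_C2.
exists (d%:R * `|M|) => [|x v]; first by rewrite mulr_ge0.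
rewrite [leLHS]/Num.norm/= mx_normrE; apply/bigmax_leP; split.
  by rewrite !mulr_ge0.
move=> [i j] _ /=; rewrite mxE [X in _ + X]mxE.
have := @mean_value R (fun u => jacobian b (x + u *: v) i j)
  (fun u => ('D_v (jacobian b) (x + u *: v)) i j) (d%:R * `|M| * `|v|).
rewrite scale1r scale0r addr0; apply.
  move=> u; apply: is_derive_entry; apply: is_derive_line.
  exact: diff_derivable.
move=> u _; rewrite deriveE//.
rewrite [v in 'd _ _ v]row_sum_delta linear_sum summxE (le_trans (ler_norm_sum _ _ _))//.
rewrite -mulrA mulr_natl -[leRHS](_ : \sum_(k < d) `|M| * `|v| = _); last first.
  by rewrite sumr_const card_ord.
apply: ler_sum => k _; rewrite linearZ -deriveE// mxE normrM mulrC ler_pM//.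
  exact: le_trans (bM _ _ _ _) (ler_norm _).
exact: ler_coord_norm.
Qed.

(** The bound on the second derivatives makes the first-order expansion of the
drift quadratically accurate, uniformly in the base point. *)
Lemma drift_taylor : exists2 C : R, 0 <= C &
  forall x v, `|b (x + v) - b x - v *m jacobian b x| <= C * `|v| ^+ 2.
Proof.
have [C C0 JC] := jacobian_lipschitz; have [db _ _] := b_C2.
exists (d%:R * C) => [|x v]; first by rewrite mulr_ge0.
apply: ler_norm_coord => [|k]; first by rewrite !mulr_ge0// exprn_ge0.
have := @mean_value R (fun u => (b (x + u *: v) - u *: (v *m jacobian b x)) 0 k)
  (fun u => (v *m (jacobian b (x + u *: v) - jacobian b x)) 0 k) (d%:R * C * `|v| ^+ 2).
rewrite !scale1r !scale0r addr0 subr0 => H.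
have -> : (b (x + v) - b x - v *m jacobian b x) 0 k =
  (b (x + v) - v *m jacobian b x) 0 k - b x 0 k by rewrite !mxE; ring.
apply: H.
  move=> u; apply: is_derive_entry; rewrite mulmxBr.
  apply: is_deriveB.
    by rewrite -deriveEjacobian//; apply: is_derive_line; exact: diff_derivable.
  have := @is_derive_line R _ _ (fun x : 'rV[R]_d => x) 0 (v *m jacobian b x) u (@derivable_id _ _ _ _).
  by rewrite derive_id; under eq_fun do rewrite add0r.
move=> u /andP[u0 u1].
rewrite (le_trans (ler_coord_norm _ _))// (le_trans (norm_mulmx _ _))//.
rewrite -mulrA -mulrA ler_wpM2l// expr2 mulrA ler_wpM2r//.
by rewrite (le_trans (JC _ _))// ler_wpM2l// normrZ ger0_norm// ler_piMl.
Qed.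

Lemma drift_locally_lipschitz (m : R) : exists2 K : R, 0 < K &
  forall x y, `|x| <= m -> `|y| <= m -> `|b x - b y| <= K * `|x - y|.
Proof.
have [C C0 bC] := drift_taylor; have [C1 C10 JC] := jacobian_lipschitz.
pose K := d%:R * (`|jacobian b 0| + C1 * `|m|) + C * (2 * `|m|).
have K0 : 0 <= K by rewrite addr_ge0// mulr_ge0// ?addr_ge0// mulr_ge0.
exists (K + 1) => [|y x ym xm]; first by rewrite ltr_wpDl.
pose v := y - x; have vm : `|v| <= 2 * `|m|.
  rewrite (le_trans (ler_normB _ _))// mulr2n mulrDl mul1r.
  by rewrite lerD// (le_trans _ (ler_norm m)).
have yE : y = x + v by rewrite addrC subrK.
rewrite {1}yE -/v; move: (bC x v) => {}bC.
rewrite -(subrK (v *m jacobian b x) (_ - _)) addrC (le_trans (ler_normD _ _))//.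
rewrite mulrDl mul1r ler_wpDr// mulrDl lerD//.
  rewrite (le_trans (norm_mulmx _ _))// ler_wpM2r// ler_wpM2l//.
  rewrite -(subrK (jacobian b 0) (jacobian b x)) addrC (le_trans (ler_normD _ _))// lerD2l.
  have := JC 0 x; rewrite add0r => /le_trans; apply.
  by rewrite ler_wpM2l// (le_trans xm)// ler_norm.
rewrite (le_trans bC)// -mulrA ler_wpM2l// expr2 ler_wpM2r//.
Qed.

Lemma continuous_jacobian_along (y : R -> 'rV[R]_d) i j : continuous y ->
  continuous (fun s => jacobian b (y s) i j).
Proof.
have [_ dJ _] := b_C2; move=> cy s.
apply: (@continuous_comp _ _ _ (fun s => jacobian b (y s)) (fun M : 'M[R]_d => M i j)).
  apply: (@continuous_comp _ _ _ y (jacobian b)); first exact: cy.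
  exact: differentiable_continuous.
exact: coord_continuous.
Qed.

Lemma drift_continuous : continuous b.
Proof. by have [db _ _] := b_C2 => x; exact: differentiable_continuous. Qed.

(** The one-sided condition between x + h v and x is divided by h^2, with h = 2^-n
tending to 0. *)
Lemma one_sided_jacobian (L : R) : one_sided_lipschitz b L ->
  forall x v, dotp v (v *m jacobian b x) <= L * enorm v ^+ 2.
Proof.
move=> bL x v; have [C C0 bC] := drift_taylor.
apply: (ler_cvg0 (cvg_geo_half (enorm v * (d%:R * (C * `|v| ^+ 2))))) => n.
set h := 2^-1 ^+ n; have h0 : 0 < h by rewrite exprn_gt0// invr_gt0.
have := bL (x + h *: v) x; rewrite addrAC subrr add0r enormZ (gtr0_norm h0).
have := bC x (h *: v); set r := b _ - b x - _ => rC.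
have -> : b (x + h *: v) - b x = r + h *: (v *m jacobian b x).
  by rewrite /r -scalemxAl addrNK.
rewrite dotpDr dotpZl dotpZr [in X in _ + X]dotpZl exprMn => H.
have rn : - (enorm v * (d%:R * (C * (h * `|v|) ^+ 2))) <= dotp v r.
  rewrite lerNl (le_trans (ler_norm _))// normrN (le_trans (normr_dotp_le _ _))//.
  rewrite ler_wpM2l ?enorm_ge0// (le_trans (enorm_le_norm _))// ler_wpM2l//.
  by move: rC; rewrite normrZ (gtr0_norm h0).
rewrite -(ler_pM2l (exprn_gt0 2 h0)).
have := ler_wpM2l (ltW h0) rn; rewrite exprMn.
move: H; move: (dotp v r) (dotp v (v *m _)) (enorm v) `|v| => A B e a; clear => H1 H2.
move: d%:R H2 => D H2; nra.
Qed.

End drift_regularity.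

(** * Equations driven by a fixed path *)

Lemma linear_growth_bound (R : realType) (l e D : R) : 0 <= l -> 0 <= D -> 0 <= e ->
  l * e ^+ 2 + e * D <= (l + D) * (1 + e ^+ 2).
Proof.
move=> l0 D0 e0; have : 0 <= D * (e ^+ 2 - e + 1).
  by rewrite mulr_ge0//; have := sqr_ge0 (e - 1); nra.
lra.
Qed.

Lemma absorb_cross_term (R : realType) (l w a : R) :
  w * a + l * w ^+ 2 <= (l + 1) * w ^+ 2 + a ^+ 2.
Proof. have := sqr_ge0 (w - a); have := sqr_ge0 (w + a); nra. Qed.

(** Only s is confined to the segment: the point r close to it may lie outside,
which spares case distinctions at the end points. *)
Lemma segment_unif_continuous (R : realType) (V : normedModType R) (f : R -> V) (T e : R) :
  continuous f -> 0 < e -> exists2 delta : R, 0 < delta &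
    forall r s, 0 <= s <= T -> `|r - s| <= delta -> `|f r - f s| <= e.
Proof.
move=> cf e0.
have /compact_near_coveringP cpt := @segment_compact R 0 T.
suff H : \forall delta \near (0 : R)^'+, `[0, T] `<=`
    (fun s => forall r, `|r - s| <= delta -> `|f r - f s| <= e).
  near (0 : R)^'+ => delta; exists delta => // r s sT.
  have : [set` `[0, T]] s by rewrite /= in_itv.
  by move: s sT r; near: delta; apply: filterS H => delta H s sT r /H; apply.
apply: cpt.
  move=> x _; have e2 : 0 < e / 2 by rewrite divr_gt0.
  have /cvgrPdist_le/(_ _ e2)[eta /= eta0 fx] := cf x.
  have eta2 : 0 < eta / 2 by rewrite divr_gt0.
  near=> s delta => r /= rs.
  have sx : `|x - s| < eta / 2 by near: s; apply: cvgr_dist_lt => //; exact: cvg_id.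
  have de : delta < eta / 2 by near: delta; exact: nbhs_right_lt.
  rewrite (splitr e) (le_trans (ler_distD (f x) _ _))// lerD//.
    rewrite distrC fx//= (le_lt_trans (ler_distD s _ _))// (splitr eta) ltrD//.
    by rewrite distrC (le_lt_trans rs).
  by rewrite fx//= (lt_trans sx)// ltr_pdivrMr// ltr_pMr// ltr1n.
Unshelve. all: by end_near. Qed.

Section pathwise_flow.
Context {R : realType} {d : nat}.
Implicit Types (g y : R -> 'rV[R]_d) (x u : 'rV[R]_d).

Lemma continuous_mulmx (f : R -> 'rV[R]_d) (M : R -> 'M[R]_d) : continuous f ->
  (forall i j, continuous (fun s => M s i j)) -> continuous (fun s => f s *m M s).
Proof.
move=> cf cM; apply: continuous_rowP => j.
under eq_fun do rewrite mxE.
move=> s; apply: cvg_big => [|i _]; first exact: add_continuous.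
by apply: cvgM; [exact: continuous_coord|exact: cM].
Qed.

Lemma continuous_bounded y (T : R) : continuous y ->
  exists2 m : R, 0 <= m & forall s, 0 <= s <= T -> `|y s| <= m.
Proof.
move=> cy; have [T0|T0] := ltP T 0.
  by exists 0 => // s /andP[s0 /(le_trans s0)]; rewrite leNgt T0.
have cn : {within `[0, T], continuous (fun s => `|y s|)}.
  by apply: continuous_subspaceT => s; apply: cvg_norm; exact: cy.
have [c _ H] := EVT_max T0 cn.
by exists `|y c| => // s sT; apply: H; rewrite in_itv.
Qed.

Lemma continuous_comp_path (b : 'rV[R]_d -> 'rV[R]_d) y : continuous b ->
  continuous y -> continuous (fun s => b (y s)).
Proof. by move=> cb cy s; apply: (@continuous_comp _ _ _ y b); [exact: cy|exact: cb]. Qed.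

Lemma continuous_rowB (f g : R -> 'rV[R]_d) : continuous f -> continuous g ->
  continuous (fun s => f s - g s).
Proof. by move=> cf cg s; apply: cvgB; [exact: cf|exact: cg]. Qed.

(** The equation with the random term sigma B replaced by one path g. *)
Definition driven_path (b : 'rV[R]_d -> 'rV[R]_d) g x y :=
  continuous y /\ forall t, 0 <= t -> y t = x + time_integral (fun s => b (y s)) t + g t.

Definition tangent_path (b : 'rV[R]_d -> 'rV[R]_d) y u (V : R -> 'rV[R]_d) :=
  continuous V /\
  forall t, 0 <= t -> V t = u + time_integral (fun s => V s *m jacobian b (y s)) t.

Context (b : 'rV[R]_d -> 'rV[R]_d) (b_C2 : C2 b)
  (b_D2 : bounded_second_derivatives b)
  (L : R) (L_gt0 : 0 < L) (b_lip : one_sided_lipschitz b L).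

Let cb : continuous b := drift_continuous b_C2.

(** Subtracting the noise turns the equation into an ordinary differential
equation with the time-dependent field z |-> b (z + g s). *)
Lemma driven_path_exists g x : continuous g -> exists y, driven_path b g x y.
Proof.
move=> cg; have [|||z cz zE] := @integral_curve_exists R d (fun s z => b (z + g s)) x.
- move=> r y cr cy; apply: continuous_comp_path => // s.
  by apply: cvgD; [exact: cy|apply: (@continuous_comp _ _ _ r g); [exact: cr|exact: cg]].
- move=> T m; have [N N0 gN] := continuous_bounded T cg.
  have [K K0 bK] := drift_locally_lipschitz b_C2 b_D2 (m + N).
  exists K => // s y z sT ym zm; rewrite (le_trans (bK _ _ _ _))//.
  + by rewrite (le_trans (ler_normD _ _))// lerD// gN.
  + by rewrite (le_trans (ler_normD _ _))// lerD// gN.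
  + by rewrite opprD addrACA subrr addr0.
- move=> T; have [N N0 gN] := continuous_bounded T (continuous_comp_path cb cg).
  exists (L + d%:R * N) => [|s y sT].
    by rewrite addr_ge0 ?(ltW L_gt0)// mulr_ge0.
  have H1 := b_lip (y + g s) (g s); rewrite addrK in H1.
  rewrite -(subrK (b (g s)) (b (y + g s))) dotpDr.
  have H2 : dotp y (b (g s)) <= enorm y * (d%:R * N).
    rewrite (le_trans (dotp_le _ _))// ler_wpM2l ?enorm_ge0//.
    by rewrite (le_trans (enorm_le_norm _))// ler_wpM2l// gN.
  rewrite (le_trans (lerD H1 H2))//.
  have := enorm_ge0 y; have : 0 <= d%:R * N by rewrite mulr_ge0.
  by move=> *; apply: linear_growth_bound => //; exact: ltW.
exists (fun s => z s + g s); split => [s|t t0].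
  by apply: cvgD; [exact: cz|exact: cg].
by rewrite zE.
Qed.

(** The driving path cancels in the difference of two solutions, to which the
one-sided condition then applies through the energy estimate. *)
Lemma driven_path_contract g x x' y y' t : continuous g -> 0 <= t ->
  driven_path b g x y -> driven_path b g x' y' ->
  enorm (y t - y' t) <= expR (L * t) * enorm (x - x').
Proof.
move=> cg t0 [cy yE] [cy' yE'].
have cby := continuous_comp_path cb cy; have cby' := continuous_comp_path cb cy'.
have cf : continuous (fun s => b (y s) - b (y' s)).
  exact: continuous_rowB.
have yy s : 0 <= s -> y s - y' s = (x - x') + time_integral (fun s => b (y s) - b (y' s)) s.
  have E (u u' p q r : 'rV[R]_d) : u + p + r - (u' + q + r) = u - u' + (p - q).
    by apply/rowP => i; rewrite !mxE; ring.
  move=> s0; rewrite (yE _ s0) (yE' _ s0) time_integralB; [exact: E|exact: cby|exact: cby'].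
have := @energy_gronwall R d _ (x - x') L 0 t cf (ltW L_gt0) (lexx 0) t0.
rewrite -yy// mulr0 mul0r addr0 => H.
rewrite -(@ler_pXn2r _ 2)// ?nnegrE ?enorm_ge0 ?mulr_ge0 ?expR_ge0 ?enorm_ge0//.
rewrite exprMn -expRM_natl mulrA; apply: H => s /andP[s0 _].
by rewrite -yy ?(ltW s0)// addr0; exact: b_lip.
Qed.

Lemma tangent_path_exists y u : continuous y -> exists V, tangent_path b y u V.
Proof.
move=> cy; have [|||V cV VE] := @integral_curve_exists R d (fun s z => z *m jacobian b (y s)) u.
- move=> r z cr cz; apply: continuous_mulmx => // i j.
  apply: (@continuous_jacobian_along R d b b_C2 (fun s => y (r s))) => s.
  by apply: (@continuous_comp _ _ _ r y); [exact: cr|exact: cy].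
- move=> T m; have [N N0 yN] := continuous_bounded T cy.
  have [C C0 JC] := jacobian_lipschitz b_C2 b_D2.
  pose K := d%:R * (`|jacobian b 0| + C * N).
  have K0 : 0 <= K by rewrite mulr_ge0// addr_ge0// mulr_ge0.
  exists (K + 1) => [|s z z' sT _ _]; first by rewrite ltr_wpDl.
  rewrite -mulmxBl (le_trans (norm_mulmx _ _))// ler_wpM2r//.
  rewrite ler_wpDr// ler_wpM2l//.
  rewrite -(subrK (jacobian b 0) (jacobian b _)) addrC (le_trans (ler_normD _ _))// lerD2l.
  by have := JC 0 (y s); rewrite add0r => /le_trans; apply; rewrite ler_wpM2l// yN.
- move=> T; exists L => [|s z _]; first exact: ltW.
  rewrite (le_trans (one_sided_jacobian b_C2 b_D2 b_lip _ _))//.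
  by rewrite ler_wpM2l ?(ltW L_gt0)// lerDr.
by exists V.
Qed.

(** The difference y' - y - V solves the linearized equation up to the Taylor
remainder of the drift. That remainder is quadratic in y' - y, hence in u by
contraction, with a constant that depends neither on the driving path nor on
the starting point. *)
Lemma driven_path_differentiable t : 0 <= t -> exists2 D : R, 0 <= D &
  forall g x u y y' V, continuous g -> driven_path b g x y ->
    driven_path b g (x + u) y' -> tangent_path b y u V ->
    enorm (y' t - y t - V t) <= D * enorm u ^+ 2.
Proof.
move=> t0; have [C C0 bC] := drift_taylor b_C2 b_D2.
pose A := d%:R * C * expR (L * t) ^+ 2.
have A0 : 0 <= A by rewrite !mulr_ge0// exprn_ge0// expR_ge0.
pose E := expR (2 * (L + 1) * t) * (2 * t).
have E0 : 0 <= E by rewrite mulr_ge0 ?expR_ge0// mulr_ge0.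
exists (Num.sqrt E * A) => [|g x u y y' V cg Dy Dy' [cV VE]].
  by rewrite mulr_ge0 ?sqrtr_ge0.
have contr s : 0 <= s <= t -> enorm (y' s - y s) <= expR (L * t) * enorm u.
  move=> /andP[s0 st]; rewrite (le_trans (driven_path_contract cg s0 Dy' Dy))//.
  rewrite addrAC subrr add0r ler_wpM2r ?enorm_ge0// ler_expR ler_wpM2l//.
  exact: ltW.
have [cy yE] := Dy; have [cy' yE'] := Dy'.
have cby := continuous_comp_path cb cy; have cby' := continuous_comp_path cb cy'.
have cVJ : continuous (fun s => V s *m jacobian b (y s)).
  by apply: continuous_mulmx => // i j; exact: continuous_jacobian_along.
have cbb : continuous (fun s => b (y' s) - b (y s)).
  exact: continuous_rowB.
have cf : continuous (fun s => b (y' s) - b (y s) - V s *m jacobian b (y s)).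
  exact: continuous_rowB.
pose f (s : R) : 'rV[R]_d := b (y' s) - b (y s) - V s *m jacobian b (y s).
pose W s := y' s - y s - V s.
have WE s : 0 <= s -> W s = 0 + time_integral f s.
  move=> s0; rewrite /W (yE _ s0) (yE' _ s0) (VE _ s0) add0r /f.
  rewrite time_integralB; [|exact: cbb|exact: cVJ].
  rewrite time_integralB; [|exact: cby'|exact: cby].
  have E' (u' v w p q r : 'rV[R]_d) : u' + v + p + q - (u' + r + q) - (v + w) = p - r - w.
    by apply/rowP => i; rewrite !mxE; ring.
  exact: E'.
have := @energy_gronwall R d f 0 (L + 1) ((A * enorm u ^+ 2) ^+ 2) t cf
  (addr_ge0 (ltW L_gt0) ler01) (sqr_ge0 _) t0.
rewrite -WE// enorm0 expr0n/= add0r => H.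
rewrite -(@ler_pXn2r _ 2)// ?nnegrE ?enorm_ge0 ?mulr_ge0 ?sqrtr_ge0 ?sqr_ge0//.
rewrite -/(W t) -[Num.sqrt E * _ * _]mulrA [leRHS]exprMn (sqr_sqrtr E0).
have -> : E * (A * enorm u ^+ 2) ^+ 2 =
    expR (2 * (L + 1) * t) * (2 * (A * enorm u ^+ 2) ^+ 2 * t).
  by rewrite /E -[LHS]mulrA; congr (_ * _); exact: mulrAC.
apply: H => s /andP[s0 st]; rewrite -WE ?(ltW s0)//.
have -> : f s = (b (y' s) - b (y s) - (y' s - y s) *m jacobian b (y s)) + W s *m jacobian b (y s).
  by rewrite /f /W [(y' s - y s - V s) *m _]mulmxBl addrA subrK.
rewrite dotpDr.
have H1 := one_sided_jacobian b_C2 b_D2 b_lip (y s) (W s).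
have H2 : dotp (W s) (b (y' s) - b (y s) - (y' s - y s) *m jacobian b (y s)) <=
    enorm (W s) * (A * enorm u ^+ 2).
  rewrite (le_trans (dotp_le _ _))// ler_wpM2l ?enorm_ge0//.
  rewrite (le_trans (enorm_le_norm _))// /A -!mulrA ler_wpM2l//.
  have := bC (y s) (y' s - y s); rewrite subrKC => /le_trans; apply.
  rewrite ler_wpM2l// mulrA -expr2 -exprMn ler_pXn2r ?nnegrE ?mulr_ge0 ?expR_ge0 ?enorm_ge0//.
  by rewrite (le_trans (norm_le_enorm _))// contr// (ltW s0) (ltW st).
rewrite (le_trans (lerD H2 H1))//.
exact: absorb_cross_term.
Qed.

End pathwise_flow.

(** * The Euler scheme *)

Section euler_scheme.
Context {R : realType} {d : nat}.
Implicit Types (g y : R -> 'rV[R]_d) (x : 'rV[R]_d).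

Fixpoint euler (b : 'rV[R]_d -> 'rV[R]_d) (h : R) (dg : nat -> 'rV[R]_d) x k :=
  if k is k'.+1 then
    let z := euler b h dg x k' in z + h *: b z + dg k'
  else x.

(** The drift is only locally Lipschitz, so the bound on the error and the
fact that the scheme stays in a fixed ball are proved by the same induction. *)
Lemma euler_error (b : 'rV[R]_d -> 'rV[R]_d) (g y : R -> 'rV[R]_d) x
    (h T K m e : R) (n : nat) :
  continuous b -> driven_path b g x y -> g 0 = 0 -> 0 <= h -> n%:R * h <= T ->
  0 < K -> 0 <= e ->
  (forall u v, `|u| <= m + 1 -> `|v| <= m + 1 -> `|b u - b v| <= K * `|u - v|) ->
  (forall s, 0 <= s <= T -> `|y s| <= m) ->
  (forall r s, 0 <= s <= T -> `|r - s| <= h -> `|b (y r) - b (y s)| <= e * K) ->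
  e * expR (K * T) <= 1 ->
  `|euler b h (fun k => g (k.+1%:R * h) - g (k%:R * h)) x n - y (n%:R * h)|
    <= e * expR (K * T).
Proof.
move=> cb [cy yE] g0 h0 nT K0 e0 bK ym mod e1.
pose z k := euler b h (fun k => g (k.+1%:R * h) - g (k%:R * h)) x k.
have cby : continuous (fun s => b (y s)) by exact: continuous_comp_path.
have pow k : (k <= n)%N -> (1 + h * K) ^+ k <= expR (K * T).
  move=> kn; rewrite (@le_trans _ _ (expR (h * K) ^+ k))//.
    rewrite lerXn2r ?nnegrE ?expR_ge0//; first by rewrite addr_ge0// mulr_ge0// ltW.
    exact: expR_ge1Dx.
  rewrite -expRM_natl ler_expR mulrCA mulrA (mulrC K) ler_wpM2r ?(ltW K0)//.
  by rewrite (le_trans _ nT)// mulrC ler_wpM2r// ler_nat.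
have pow1 k : 1 <= (1 + h * K) ^+ k.
  by rewrite exprn_ege1// lerDl mulr_ge0// ltW.
suff H k : (k <= n)%N -> `|z k - y (k%:R * h)| <= e * ((1 + h * K) ^+ k - 1).
  rewrite (le_trans (H n (leqnn n)))// ler_wpM2l//.
  by rewrite (le_trans _ (pow n _))// gerBl.
elim: k => [_|k IH kn].
  rewrite /z/= mul0r yE// time_integral_le0// g0 !addr0 !subrr normr0.
  by rewrite mulr0.
have {}IH := IH (ltnW kn).
pose s := k%:R * h; pose s' := k.+1%:R * h.
have s0 : 0 <= s by rewrite mulr_ge0.
have ss' : s' - s = h by rewrite /s /s' -mulrBl -natrB// subSnn mul1r.
have s'T : s' <= T by rewrite (le_trans _ nT)// ler_wpM2r// ler_nat.
have les : s <= s' by rewrite -subr_ge0 ss'.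
have sT : 0 <= s <= T by rewrite s0 (le_trans les).
have ze : `|z k - y s| <= 1.
  rewrite (le_trans IH)// (le_trans _ e1)// ler_wpM2l//.
  by rewrite (le_trans _ (pow k _)) ?(ltnW kn)// gerBl.
have inc : `|time_integral (fun s => b (y s)) s' - time_integral (fun s => b (y s)) s
    - h *: b (y s)| <= h * (e * K).
  have := @time_integral_increment _ _ _ (b (y s)) (e * K) s s' cby s0 les; rewrite ss'; apply.
  move=> r /andP[sr rs']; apply: mod => //.
  by rewrite ger0_norm ?subr_ge0// -ss' lerB.
have -> : z k.+1 - y s' = (z k - y s) + h *: (b (z k) - b (y s))
   - (time_integral (fun s => b (y s)) s' - time_integral (fun s => b (y s)) s
    - h *: b (y s)).
  have -> : z k.+1 = z k + h *: b (z k) + (g s' - g s) by [].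
  rewrite (yE s')// ?(le_trans s0)// {1}(yE s)//.
  move: (time_integral _ _) (time_integral _ _) (b (y s)) => P Q bys.
  by apply/rowP => i; rewrite !mxE; ring.
rewrite (le_trans (ler_normB _ _))//.
apply: (le_trans (lerD (ler_normD _ _) inc)).
have bb : `|h *: (b (z k) - b (y s))| <= h * (K * `|z k - y s|).
  rewrite normrZ (ger0_norm h0) ler_wpM2l//; apply: bK.
    rewrite -(subrK (y s) (z k)) addrC (le_trans (ler_normD _ _))// lerD//.
    exact: ym.
  by rewrite (le_trans (ym _ sT))// lerDl.
rewrite exprS; have : 0 <= h * K by rewrite mulr_ge0// ltW.
move: IH bb; rewrite -/s.
move: (h) (K) (e) ((1 + h * K) ^+ k) `|h *: (b (z k) - b (y s))| `|z k - y s| => h' K' e' C B A.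
clear=> H1 H2 H3.
have : (1 + h' * K') * A <= (1 + h' * K') * (e' * (C - 1)).
  by rewrite ler_wpM2l// addr_ge0.
lra.
Qed.

(** The local error of the scheme is controlled by the modulus of continuity of
the drift along the solution, because the driving path enters the scheme
exactly. *)
Lemma euler_cvg (b : 'rV[R]_d -> 'rV[R]_d) g y x t : C2 b ->
  bounded_second_derivatives b -> continuous g -> g 0 = 0 -> driven_path b g x y ->
  0 <= t ->
  (fun n => euler b (t / n.+1%:R) (fun k => g (k.+1%:R * (t / n.+1%:R)) -
     g (k%:R * (t / n.+1%:R))) x n.+1) @ \oo --> y t.
Proof.
move=> b2 bD cg g0 Dy t0; have [cy yE] := Dy.
have cb := drift_continuous b2.
have [m m0 ym] := continuous_bounded t cy.
have [K K0 bK] := drift_locally_lipschitz b2 bD (m + 1).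
apply/cvgrPdist_le => eta eta0.
pose e := Num.min 1 eta / expR (K * t).
have eE : e * expR (K * t) = Num.min 1 eta by rewrite /e divfK// gt_eqF// expR_gt0.
have e0 : 0 < e by rewrite divr_gt0 ?expR_gt0// lt_min ltr01.
have [delta d0 mod] := segment_unif_continuous t (continuous_comp_path cb cy) (mulr_gt0 e0 K0).
have : t / n.+1%:R @[n --> \oo] --> 0.
  by rewrite -[X in _ --> X](mulr0 t); apply: cvgM; [exact: cvg_cst|exact: cvg_harmonic].
move=> /cvgrPdist_le/(_ _ d0); apply: filterS => n; rewrite sub0r normrN => nd.
have h0 : 0 <= t / n.+1%:R by rewrite divr_ge0.
have nt : n.+1%:R * (t / n.+1%:R) = t by rewrite mulrC divfK.
rewrite distrC -[X in y X]nt.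
have := @euler_error b g y x (t / n.+1%:R) t K m e n.+1 cb Dy g0 h0.
rewrite {1}nt eE ge_min lexx => /(_ isT K0 (ltW e0) bK ym)H.
rewrite (le_trans (H _ _))//; last by rewrite ge_min lexx orbT.
  move=> r s sT rs; apply: mod => //.
  by rewrite (le_trans rs)// -(ger0_norm h0).
by rewrite lexx.
Qed.

End euler_scheme.

(** * Laws and Borel sets of row vectors *)

Section measure_lemmas.
Context {R : realType}.

Section law.
Context {d1} {T1 : measurableType d1}.

Definition law d (T : measurableType d) (P : probability T R) (Z : T -> T1)
    (mZ : measurable_fun setT Z) : probability T1 R :=
  distribution P (HB.pack_for {mfun T >-> T1} Z (isMeasurableFun.Build _ _ _ _ Z mZ)).

Lemma integral_law d (T : measurableType d) (P : probability T R) (Z : T -> T1)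
  (mZ : measurable_fun setT Z) (f : T1 -> \bar R) : measurable_fun setT f ->
  (forall x, 0 <= f x)%E -> (\int[law P mZ]_x f x = \int[P]_w f (Z w))%E.
Proof. by move=> mf f0; rewrite [LHS]ge0_integral_pushforward. Qed.

End law.

Section rectangles.
Context {d1 d2} {T1 : measurableType d1} {T2 : measurableType d2}.

Lemma rectangle_measure_unique (P Q : probability (T1 * T2)%type R) :
  (forall A B, measurable A -> measurable B -> P (A `*` B) = Q (A `*` B)) ->
  forall C, measurable C -> P C = Q C.
Proof.
move=> PQ C mC.
apply: (measure_unique [set A `*` B | A in measurable & B in measurable] (fun=> setT)) => //.
- exact: measurable_prod_measurableType.
- move=> _ _ [A mA [B mB <-]] [A' mA' [B' mB' <-]]; rewrite -setXI.
  by exists (A `&` A'); [exact: measurableI|exists (B `&` B'); [exact: measurableI|]].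
- by move=> n; exists setT => //; exists setT => //; rewrite setXTT.
- by apply/seteqP; split => // z _; exists 0%N.
- by move=> _ [A mA [B mB <-]]; exact: PQ.
- by move=> _; apply: le_lt_trans (probability_le1 P measurableT) _; rewrite ltry.
Qed.

Lemma independent_joint_law d (T : measurableType d) (P : probability T R)
    (Z1 : T -> T1) (Z2 : T -> T2) (m1 : measurable_fun setT Z1)
    (m2 : measurable_fun setT Z2) :
  (forall A B, measurable A -> measurable B ->
     P (Z1 @^-1` A `&` Z2 @^-1` B) = (P (Z1 @^-1` A) * P (Z2 @^-1` B))%E) ->
  forall C, measurable C ->
    P ((fun w => (Z1 w, Z2 w)) @^-1` C) = (law P m1 \x law P m2)%E C.
Proof.
move=> ind C mC; apply/esym.
rewrite -[RHS]/(law P (measurable_fun_pair m1 m2) C).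
by apply: product_measure_unique => // A B mA mB; exact: ind.
Qed.

End rectangles.

Lemma integral_eq_measure d (T : measurableType d) (P Q : {measure set T -> \bar R})
   (f : T -> \bar R) : (forall A, measurable A -> P A = Q A) ->
  (\int[P]_x f x = \int[Q]_x f x)%E.
Proof. by move=> PQ; apply: eq_measure_integral => A mA _; exact: PQ. Qed.

End measure_lemmas.

Section borel_row_vectors.
Context {R : realType} {d : nat}.

Lemma continuous_borel_measurable (f : 'rV[R]_d -> R) : continuous f ->
  measurable_fun setT (f : borelE R d -> R).
Proof.
move=> /continuousP cf; apply: (measurability _ (RGenOpens.measurableE R)).
move=> _ [_ [a [b ->] <-]]; rewrite setTI; apply: sub_sigma_algebra.
exact/cf/interval_open.
Qed.

Lemma continuous_borel_measurable_row (d' : nat) (f : 'rV[R]_d -> 'rV[R]_d') :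
  continuous f -> measurable_fun setT (f : borelE R d -> borelE R d').
Proof.
move=> /continuousP cf; apply: (@measurability _ _ (borelE R d) (borelE R d') setT f (@open 'rV[R]_d')) => //.
move=> _ [U oU <-]; rewrite setTI; apply: sub_sigma_algebra.
exact: cf.
Qed.

Lemma measurable_coord i :
  measurable_fun setT ((fun x : 'rV[R]_d => x 0 i) : borelE R d -> R).
Proof. by apply: continuous_borel_measurable; exact: coord_continuous. Qed.

Definition rational_box (c : 'rV[rat]_d * rat) : set 'rV[R]_d :=
  [set x | forall i, `|x 0 i - ratr (c.1 0 i)| < ratr c.2].

(** Boxes with rational data form a countable base of the topology, which reduces
Borel measurability of a random vector to that of its coordinates. *)
Lemma open_rational_boxes (U : set 'rV[R]_d) : open U ->
  U = \bigcup_(c : 'rV[rat]_d * rat)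
        [set x | rational_box c x /\ rational_box c `<=` U].
Proof.
rewrite openE => oU; apply/seteqP; split => [x Ux|x [c _ [cx]]]; last by apply.
have /nbhs_ballP[e /= e0 xe] := oU x Ux.
have e2 : 0 < e / 2 by rewrite divr_gt0.
have [r] := rat_in_itvoo e2; rewrite in_itv/= => /andP[r0 re].
have /choice[q qx] i : exists q : rat, `|x 0 i - ratr q| < ratr r.
  have xr : x 0 i - ratr r < x 0 i + ratr r by rewrite ltrD2l gtrN.
  have [q] := rat_in_itvoo xr; rewrite in_itv/= => /andP[q1 q2].
  by exists q; rewrite ltr_norml; lra.
exists (\row_i q i, r) => //; split => [i|y /= yq]; first by rewrite /= mxE.
apply: xe; split => // i j; rewrite ord1 /ball/=.
have := yq j; rewrite mxE => yqj; rewrite (splitr e).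
rewrite (le_lt_trans (ler_distD (ratr (q j)) _ _))// ltrD//.
  exact: lt_trans re.
by rewrite distrC (lt_trans yqj).
Qed.

Lemma measurable_rectangle d0 (T : measurableType d0) (Z : T -> 'rV[R]_d) (A : 'I_d -> set R) :
  (forall i, measurable_fun setT (fun w => Z w 0 i)) ->
  (forall i, measurable (A i)) ->
  measurable [set w | forall i, A i (Z w 0 i)].
Proof.
move=> mZ mA; rewrite (_ : mkset _ = \bigcap_(i in [set: 'I_d]) ((fun w => Z w 0 i) @^-1` A i)).
  apply: fin_bigcap_measurable => [|i _]; first exact: finite_finset.
  by rewrite -[X in measurable X]setTI; exact: mZ.
by apply/seteqP; split => [w wA i _|w wA i]; exact: wA.
Qed.

Lemma measurable_rowP d0 (T : measurableType d0) (Z : T -> 'rV[R]_d) :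
  (forall i, measurable_fun setT (fun w => Z w 0 i)) ->
  measurable_fun setT (Z : T -> borelE R d).
Proof.
move=> mZ; apply: (@measurability _ _ T (borelE R d) setT Z (@open 'rV[R]_d)) => //.
move=> _ [U /open_rational_boxes -> <-]; rewrite setTI preimage_bigcup.
apply: countable_bigcupT_measurable => [|c]; first exact: countableP.
have [cU|cU] := pselect (rational_box c `<=` U); last first.
  by rewrite (_ : _ @^-1` _ = set0)// -subset0 => w [].
rewrite (_ : _ @^-1` _ = [set w | forall i, [set` `](ratr (c.1 0 i) - ratr c.2), (ratr (c.1 0 i) + ratr c.2)[] (Z w 0 i)]); last first.
  apply/seteqP; split => [w [cw _] i|w cw].
    by rewrite /= in_itv/= -ltr_distl.
  by split => // i; have := cw i; rewrite /= in_itv/= -ltr_distl.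
by apply: (measurable_rectangle (A := fun i => [set` `](ratr (c.1 0 i) - ratr c.2), (ratr (c.1 0 i) + ratr c.2)[])).
Qed.

(* The lower orthants are the sets that a distribution function measures. *)
Definition orthant (a : 'I_d -> R) : set 'rV[R]_d := [set x | forall i, x 0 i < a i].

Lemma borel_orthants : @measurable _ (borelE R d) = <<s range orthant >>.
Proof.
apply/seteqP; split => A; last first.
  apply: smallest_sub; first exact: sigma_algebra_measurable.
  move=> _ [a _ <-]; have -> : orthant a = [set x | forall i, [set` `]-oo, a i[] (x 0 i)].
    by apply/seteqP; split => x xa i; have := xa i; rewrite /= in_itv.
  by apply: (measurable_rectangle (Z := fun x : borelE R d => x) (A := fun i => [set` `]-oo, a i[])) => // i; exact: measurable_coord.
have mid : measurable_fun setT ((fun x => x) : g_sigma_algebraType (range orthant) -> borelE R d).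
  apply: measurable_rowP => i; apply: (measurability _ (RGenInftyO.measurableE R)).
  move=> _ [_ [a ->] <-]; rewrite setTI.
  rewrite (_ : _ @^-1` _ = \bigcup_n orthant (fun j => if j == i then a else n%:R)).
    apply: bigcupT_measurable => n; apply: sub_sigma_algebra.
    by eexists.
  apply/seteqP; split => x /=; rewrite in_itv/=; last first.
    by move=> [n _ /(_ i)]; rewrite eqxx.
  move=> xa; exists (Num.truncn `|x|).+1 => // j; case: eqP => [->//|_].
  rewrite (le_lt_trans (ler_norm _))// (le_lt_trans (ler_coord_norm _ _))//.
  exact: truncnS_gt.
by move=> mA; rewrite -[A]setTI; exact: (mid measurableT A mA).
Qed.

(** The orthants are stable under intersection and generate the Borel sets. *)
Lemma orthant_measure_unique (P Q : probability (borelE R d) R) :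
  (forall a, P (orthant a) = Q (orthant a)) ->
  forall A, measurable A -> P A = Q A.
Proof.
move=> PQ A mA.
apply: (@measure_unique _ R (borelE R d) (range orthant) (fun n => orthant (fun=> n%:R)) _ _ _ _ P Q _ _ A mA).
- exact: borel_orthants.
- move=> _ _ [a _ <-] [a' _ <-]; exists (fun i => Num.min (a i) (a' i)) => //.
  apply/seteqP; split => x; rewrite /orthant/=.
    by move=> xa; split => i; have := xa i; rewrite lt_min => /andP[].
  by move=> [xa xa'] i; rewrite lt_min xa xa'.
- by move=> n; eexists.
- apply/seteqP; split => // x _; exists (Num.truncn `|x|).+1 => // j.
  rewrite (le_lt_trans (ler_norm _))// (le_lt_trans (ler_coord_norm _ _))//.
  exact: truncnS_gt.
- by move=> _ [a _ <-]; exact: PQ.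
- move=> n; apply: le_lt_trans (probability_le1 P _) _; last by rewrite ltry.
  by rewrite borel_orthants; apply: sub_sigma_algebra; eexists.
Qed.

End borel_row_vectors.

(** * The measurable flow *)

(** The total operation on the left is measurable in the sequence, and it is the
limit whenever there is one. *)
Lemma fine_limn_esup (R : realType) (u : nat -> R) (l : R) : u @ \oo --> l ->
  fine (limn_esup (fun n => (u n)%:E)) = l.
Proof.
move=> ul; have uE : (u n)%:E @[n --> \oo] --> l%:E.
  by apply: cvg_EFin => //; exact: nearW.
by rewrite (cvg_limn_einf_sup uE).2.
Qed.

Section flow.
Context {R : realType} {d : nat}.
Context (b : 'rV[R]_d -> 'rV[R]_d) (sigma : 'M[R]_d).
Implicit Types (beta : R -> 'rV[R]_d) (x : 'rV[R]_d).

Definition euler_path beta x (h : R) (n : nat) : 'rV[R]_d :=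
  euler b h (fun k => (beta (k.+1%:R * h) - beta (k%:R * h)) *m sigma^T) x n.

(** For a continuous path beta this is the solution at time t of the equation
started at x and driven by beta. The limit of Euler schemes makes sense for
every beta, and is measurable in the starting point and the driving path
together. *)
Definition flow (t : R) beta x : 'rV[R]_d :=
  \row_i fine (limn_esup (fun n => (euler_path beta x (t / n.+1%:R) n.+1 0 i)%:E)).

Definition noise beta (t : R) : 'rV[R]_d := (beta (Num.max 0 t) - beta 0) *m sigma^T.

Lemma continuous_noise beta : continuous_path beta -> continuous (noise beta).
Proof.
move=> /within_halfline_continuous cb; apply: continuous_mulmx => [|i j].
  by apply: continuous_rowB => // s; exact: cvg_cst.
by move=> s; exact: cvg_cst.
Qed.

Lemma noise0 beta : noise beta 0 = 0.
Proof. by rewrite /noise max_l// subrr mul0mx. Qed.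

Lemma euler_pathE beta x (h : R) n : 0 <= h -> euler_path beta x h n =
  euler b h (fun k => noise beta (k.+1%:R * h) - noise beta (k%:R * h)) x n.
Proof.
move=> h0; rewrite /euler_path; congr (euler _ _ _ _ _); apply/funext => k.
rewrite /noise !max_r ?mulr_ge0// -mulmxBl; congr (_ *m _).
by rewrite opprB addrA subrK.
Qed.

Lemma driven_path_flow beta x y t : C2 b -> bounded_second_derivatives b ->
  continuous_path beta -> driven_path b (noise beta) x y -> 0 <= t ->
  y t = flow t beta x.
Proof.
move=> b2 bD cbeta Dy t0; apply/rowP => i; rewrite mxE; apply/esym/fine_limn_esup.
have := euler_cvg b2 bD (continuous_noise cbeta) (noise0 beta) Dy t0.
move=> H; have := cvg_comp _ _ H (@coord_continuous R 1 d 0 i (y t)).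
apply: cvg_trans; apply: near_eq_cvg; apply: nearW => n.
by rewrite euler_pathE// divr_ge0.
Qed.

Section flow_paths.
Context (b_C2 : C2 b) (b_D2 : bounded_second_derivatives b)
  (L : R) (L_gt0 : 0 < L) (b_lip : one_sided_lipschitz b L).

Lemma flow_driven beta x : continuous_path beta -> exists2 y : R -> 'rV[R]_d,
  driven_path b (noise beta) x y & forall t, 0 <= t -> y t = flow t beta x.
Proof.
move=> cbeta.
have [y Dy] := driven_path_exists b_C2 b_D2 L_gt0 b_lip x (continuous_noise cbeta).
by exists y => // t t0; exact: driven_path_flow.
Qed.

Lemma flow_contract beta x x' t : continuous_path beta -> 0 <= t ->
  enorm (flow t beta x - flow t beta x') <= expR (L * t) * enorm (x - x').
Proof.
move=> cbeta t0; have [y Dy <-//] := flow_driven x cbeta.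
have [y' Dy' <-//] := flow_driven x' cbeta.
exact: (driven_path_contract b_C2 L_gt0 b_lip (continuous_noise cbeta)).
Qed.

End flow_paths.

(** Joint measurability of the flow holds for any sigma-algebra that makes the
driving path measurable at the times in use. *)
Section flow_measurability.
Context (cb : continuous b) {dT : measure_display} {T : measurableType dT}.
Context (B : R -> T -> 'rV[R]_d).

Lemma measurable_mulmx (dS : measure_display) (S : measurableType dS)
    (Z : S -> 'rV[R]_d) (M : 'M[R]_d) :
  measurable_fun setT (Z : S -> borelE R d) ->
  measurable_fun setT ((fun w => Z w *m M) : S -> borelE R d).
Proof.
move=> mZ; apply: measurable_rowP => j.
rewrite (_ : (fun w => _) = (fun w => \sum_i Z w 0 i * M i j)); last first.
  by apply/funext => w; rewrite mxE.
apply: measurable_sum => i; apply: measurable_funM => //.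
by apply: (measurableT_comp (measurable_coord i)).
Qed.

Lemma measurable_rowD (dS : measure_display) (S : measurableType dS)
    (Z Z' : S -> 'rV[R]_d) :
  measurable_fun setT (Z : S -> borelE R d) ->
  measurable_fun setT (Z' : S -> borelE R d) ->
  measurable_fun setT ((fun w => Z w + Z' w) : S -> borelE R d).
Proof.
move=> mZ mZ'; apply: measurable_rowP => j.
under eq_fun do rewrite mxE.
by apply: measurable_funD; exact: (measurableT_comp (measurable_coord j)).
Qed.

Lemma measurable_rowZ (dS : measure_display) (S : measurableType dS) (a : R)
    (Z : S -> 'rV[R]_d) :
  measurable_fun setT (Z : S -> borelE R d) ->
  measurable_fun setT ((fun w => a *: Z w) : S -> borelE R d).
Proof.
move=> mZ; apply: measurable_rowP => j.
under eq_fun do rewrite mxE.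
by apply: measurable_funM => //; exact: (measurableT_comp (measurable_coord j)).
Qed.

Lemma measurable_rowB (dS : measure_display) (S : measurableType dS)
    (Z Z' : S -> 'rV[R]_d) :
  measurable_fun setT (Z : S -> borelE R d) ->
  measurable_fun setT (Z' : S -> borelE R d) ->
  measurable_fun setT ((fun w => Z w - Z' w) : S -> borelE R d).
Proof.
move=> mZ mZ'; under eq_fun do rewrite -scaleN1r.
by apply: measurable_rowD => //; exact: measurable_rowZ.
Qed.

Lemma measurable_euler_path (h : R) n :
  (forall k, (k <= n)%N -> measurable_fun setT (B (k%:R * h) : T -> borelE R d)) ->
  measurable_fun setT ((fun p => euler_path (B ^~ p.2) p.1 h n) :
    borelE R d * T -> borelE R d).
Proof.
elim: n => [_|n IH mB].
  exact: measurable_fst.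
have {}IH := IH (fun k kn => mB k (leqW kn)).
apply: measurable_rowD.
  apply: measurable_rowD => //; apply: measurable_rowZ.
  exact: (measurableT_comp (continuous_borel_measurable_row cb) IH).
apply: measurable_mulmx; apply: measurable_rowB.
  exact: (measurableT_comp (mB n.+1 _) measurable_snd).
exact: (measurableT_comp (mB n _) measurable_snd).
Qed.

Lemma measurable_flow t : 0 <= t ->
  (forall s, 0 <= s -> measurable_fun setT (B s : T -> borelE R d)) ->
  measurable_fun setT ((fun p => flow t (B ^~ p.2) p.1) :
    borelE R d * T -> borelE R d).
Proof.
move=> t0 mB; apply: measurable_rowP => i.
under eq_fun do rewrite mxE.
apply: measurableT_comp => //; apply: measurable_fun_limn_esup => n.
apply/measurable_EFinP; apply: (measurableT_comp (measurable_coord i)).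
by apply: measurable_euler_path => k _; apply: mB; rewrite mulr_ge0// divr_ge0.
Qed.

Lemma measurable_flow_at t x : 0 <= t ->
  (forall s, 0 <= s -> measurable_fun setT (B s : T -> borelE R d)) ->
  measurable_fun setT ((fun w => flow t (B ^~ w) x) : T -> borelE R d).
Proof.
by move=> t0 mB; apply: (measurableT_comp (measurable_flow t0 mB) (pair1_measurable (x : borelE R d))).
Qed.

End flow_measurability.

End flow.

(** * Solutions of the stochastic equation *)

Lemma continuous_path_ext (R : realType) (d : nat) (y f : R -> 'rV[R]_d) :
  continuous y -> (forall t, 0 <= t -> y t = f t) -> continuous_path f.
Proof.
move=> cy yf; apply: (within_halfline_continuous f).2.
have E : (fun t => f (Num.max 0 t)) = (fun t => y (Num.max 0 t)).
  by apply/funext => t; rewrite yf// le_max lexx.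
rewrite E; apply: (within_halfline_continuous y).1.
exact: continuous_subspaceT.
Qed.

Section processes.
Context {R : realType} {d : nat}.
Context (b : 'rV[R]_d -> 'rV[R]_d) (sigma : 'M[R]_d).
Context (b_C2 : C2 b) (b_D2 : bounded_second_derivatives b)
  (L : R) (L_gt0 : 0 < L) (b_lip : one_sided_lipschitz b L).

Let cb : continuous b := drift_continuous b_C2.

Lemma extended_path_driven (beta X : R -> 'rV[R]_d) :
  continuous_path X ->
  (forall t, 0 <= t -> X t = X 0 + time_integral (fun s => b (X s)) t
     + (beta t - beta 0) *m sigma^T) ->
  driven_path b (noise sigma beta) (X 0) (fun t => X (Num.max 0 t)).
Proof.
move=> cX XE; split; first exact/within_halfline_continuous.
move=> t t0; rewrite /noise max_r// XE//; congr (_ + _ + _).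
by apply: eq_time_integral => s /andP[s0 _]; rewrite max_r.
Qed.

Section on_a_space.
Context {dO : measure_display} {Omega : measurableType dO}.
Context (P : probability Omega R) (B : R -> Omega -> 'rV[R]_d).
Context (hB : standard_brownian_motion P B).

Lemma brownian_measurable s : 0 <= s -> random_vector (B s).
Proof. by case: hB => + _ _ _ _; apply. Qed.

Lemma brownian_continuous : {ae P, forall w, continuous_path (fun t => B t w)}.
Proof. by case: hB. Qed.

(** Pathwise uniqueness: outside a null set a solution is read off the flow, so
all statements about solutions become statements about the flow. *)
Lemma solution_flow (X : R -> Omega -> 'rV[R]_d) : sde_solution P b sigma B X ->
  {ae P, forall w, forall t, 0 <= t -> X t w = flow b sigma t (B ^~ w) (X 0 w)}.
Proof.
move=> [_ aeX]; apply: filterS2 brownian_continuous aeX => w cB [cX XE] t t0.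
have := extended_path_driven cX XE.
by move=> /(driven_path_flow b_C2 b_D2 cB)/(_ t0); rewrite max_r.
Qed.

Lemma flow_solution x :
  sde_solution P b sigma B (fun t w => flow b sigma t (B ^~ w) x) /\
  starts_at P (fun t w => flow b sigma t (B ^~ w) x) x.
Proof.
have H : {ae P, forall w, continuous_path (fun t => flow b sigma t (B ^~ w) x) /\
  (forall t, 0 <= t -> flow b sigma t (B ^~ w) x =
     x + time_integral (fun s => b (flow b sigma s (B ^~ w) x)) t
         + (B t w - B 0 w) *m sigma^T)}.
  apply: filterS brownian_continuous => w cB.
  have [y [cy yE] yF] := flow_driven sigma b_C2 b_D2 L_gt0 b_lip x cB.
  split=> [|t t0].
    exact: (continuous_path_ext cy).
  rewrite -yF// yE// /noise max_r//; congr (_ + _ + _).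
  by apply: eq_time_integral => s /andP[s0 _]; rewrite yF.
have H0 : starts_at P (fun t w => flow b sigma t (B ^~ w) x) x.
  apply: filterS H => w [_ /(_ 0 (lexx 0))].
  by rewrite time_integral_le0// subrr mul0mx !addr0.
split; last exact: H0.
split=> [t t0|].
  by apply: measurable_flow_at => // s s0; exact: brownian_measurable.
apply: filterS2 H H0 => w [cX XE] X0; split=> // t t0.
by rewrite X0; exact: XE.
Qed.

(** The columns are limits of difference quotients of the flow, which makes the
process measurable. *)
Definition flow_tangent (x : 'rV[R]_d) (t : R) (w : Omega) : 'M[R]_d :=
  \matrix_(j, i) fine (limn_esup (fun n => (n.+1%:R *
     (flow b sigma t (B ^~ w) (x + n.+1%:R^-1 *: delta_mx 0 i)
      - flow b sigma t (B ^~ w) x) 0 j)%:E)).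

(** Each column of the limit is a solution of the linearized equation because the
flow is differentiable, and linearity covers all directions at once. *)
Lemma tangent_process_exists x :
  tangent_process P b (fun t w => flow b sigma t (B ^~ w) x) (flow_tangent x).
Proof.
split=> [t t0 i j|].
  rewrite /flow_tangent; under eq_fun do rewrite mxE.
  apply: measurableT_comp => //; apply: measurable_fun_limn_esup => n.
  apply/measurable_EFinP; apply: measurable_funM => //.
  apply: (measurableT_comp (measurable_coord i)).
  by apply: measurable_rowB; apply: measurable_flow_at => // s s0; exact: brownian_measurable.
apply: filterS brownian_continuous => w cB.
have [y Dy yF] := flow_driven sigma b_C2 b_D2 L_gt0 b_lip x cB.
have [cy yE] := Dy.
have /choice[V VT] i : exists V, tangent_path b y (delta_mx 0 i) V.
  exact: (tangent_path_exists b_C2 b_D2 L_gt0 b_lip).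
have PhiV t i j : 0 <= t -> flow_tangent x t w j i = V i t 0 j.
  move=> t0; rewrite mxE; apply: fine_limn_esup.
  have [D D0 HD] := driven_path_differentiable b_C2 b_D2 L_gt0 b_lip t0.
  pose E := D * enorm (delta_mx 0 i : 'rV[R]_d) ^+ 2.
  apply/cvgrPdist_le => e e0.
  have : E * n.+1%:R^-1 @[n --> \oo] --> 0.
    rewrite -[X in _ --> X](mulr0 E).
    by apply: cvgM; [exact: cvg_cst|exact: cvg_harmonic].
  move=> /cvgrPdist_le/(_ _ e0); apply: filterS => n; rewrite sub0r normrN => En.
  have n0 : 0 < n.+1%:R :> R by [].
  set u := n.+1%:R^-1 *: delta_mx 0 i.
  have [y' Dy' yF'] := flow_driven sigma b_C2 b_D2 L_gt0 b_lip (x + u) cB.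
  have Tu : tangent_path b y u (fun t => n.+1%:R^-1 *: V i t).
    have [cV VE] := VT i; split=> [s|s s0].
      by apply: cvgZl_tmp; exact: cV.
    rewrite VE// scalerDr -time_integralZ.
      by congr (_ + _); apply: eq_time_integral => r _; rewrite scalemxAl.
    by apply: continuous_mulmx => // *; exact: continuous_jacobian_along.
  have := HD _ _ _ _ _ _ (continuous_noise cB) Dy Dy' Tu.
  rewrite yF'// yF// => H.
  apply: le_trans En; rewrite -(ler_pM2l (_ : 0 < n.+1%:R^-1)) ?invr_gt0//.
  rewrite -(gtr0_norm (_ : 0 < n.+1%:R^-1)) ?invr_gt0// -normrM.
  rewrite mulrBr mulKf ?gt_eqF// distrC.
  move: H; set W := _ - _ - _ => H.
  have -> : (flow b sigma t (B^~ w) (x + u) - flow b sigma t (B^~ w) x) 0 j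
     - n.+1%:R^-1 * V i t 0 j = W 0 j by rewrite /W !mxE.
  rewrite (le_trans (ler_coord_enorm _ _))// (le_trans H)//.
  rewrite /u enormZ exprMn /E gtr0_norm ?invr_gt0//.
  rewrite ger0_norm ?mulr_ge0 ?invr_ge0 ?sqr_ge0 ?enorm_ge0//.
  by rewrite le_eqVlt; apply/orP; left; apply/eqP; ring.
move=> v; pose U t := \sum_i v 0 i *: V i t.
have UE t : 0 <= t -> v *m (flow_tangent x t w)^T = U t.
  move=> t0; apply/rowP => j; rewrite mxE summxE; apply: eq_bigr => i _.
  by rewrite mxE PhiV// mxE.
have cV i : continuous (V i) by have [] := VT i.
have cVJ i : continuous (fun s => V i s *m jacobian b (y s)).
  by apply: continuous_mulmx => // *; exact: continuous_jacobian_along.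
have cU : continuous U.
  move=> s; apply: cvg_big => [|i _]; first exact: add_continuous.
  by apply: cvgZl_tmp; exact: cV.
split.
  by apply: (continuous_path_ext cU) => t /UE.
move=> t t0; transitivity (U t); first exact: UE.
rewrite (@eq_time_integral _ _ _ (fun s => \sum_i v 0 i *: (V i s *m jacobian b (y s)))); last first.
  move=> s /andP[s0 _]; rewrite -(yF s s0).
  transitivity (U s *m jacobian b (y s)); first by congr (_ *m _); exact: UE.
  rewrite /U mulmx_suml.
  by apply: eq_bigr => i _; rewrite scalemxAl.
have sumTI (r : seq 'I_d) : time_integral (fun s => \sum_(i <- r) v 0 i *: (V i s *m jacobian b (y s))) t
   = \sum_(i <- r) v 0 i *: time_integral (fun s => V i s *m jacobian b (y s)) t.
  elim: r => [|i r IH].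
    under eq_fun do rewrite big_nil.
    rewrite big_nil -[RHS](scale0r (time_integral (fun=> 0) t)) -time_integralZ; last exact: cst_continuous.
    by apply: eq_time_integral => s _; rewrite scale0r.
  under eq_fun do rewrite big_cons.
  rewrite big_cons time_integralD.
  - by rewrite time_integralZ// IH.
  - by move=> s; apply: cvgZl_tmp; exact: cVJ.
  - move=> s; apply: cvg_big => [|k _]; first exact: add_continuous.
    by apply: cvgZl_tmp; exact: cVJ.
rewrite sumTI; transitivity (\sum_i v 0 i *: delta_mx 0 i +
    \sum_i v 0 i *: time_integral (fun s => V i s *m jacobian b (y s)) t).
  rewrite -big_split; apply: eq_bigr => i _ /=; rewrite -scalerDr.
  by congr (_ *: _); have [_ VE] := VT i; exact: VE.
by congr (_ + _); rewrite -row_sum_delta.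
Qed.

Lemma tangent_estimate (t : R) : 0 <= t -> exists2 D : R, 0 <= D &
  forall (x u : 'rV[R]_d) X Phi, sde_solution P b sigma B X -> starts_at P X x ->
    tangent_process P b X Phi ->
    {ae P, forall w, enorm (flow b sigma t (B ^~ w) (x + u) -
       flow b sigma t (B ^~ w) x - u *m (Phi t w)^T) <= D * enorm u ^+ 2}.
Proof.
move=> t0; have [D D0 HD] := driven_path_differentiable b_C2 b_D2 L_gt0 b_lip t0.
exists D => // x u X Phi [_ aeX] X0 [_ aePhi].
apply: filterS2 (filterI brownian_continuous aeX) (filterI X0 aePhi).
move=> w [cB [cX XE]] [X0w /(_ u)[cV VE]].
have Dy := extended_path_driven cX XE; rewrite X0w in Dy.
have [y' Dy' yF'] := flow_driven sigma b_C2 b_D2 L_gt0 b_lip (x + u) cB.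
have TV : tangent_path b (fun s => X (Num.max 0 s) w) u
    (fun s => u *m (Phi (Num.max 0 s) w)^T).
  split; first exact: ((within_halfline_continuous (fun s => u *m (Phi s w)^T)).1 cV).
  move=> s s0; have Es (r : R) : 0 <= r -> Num.max 0 r = r by move=> r0; rewrite max_r.
  transitivity (u *m (Phi s w)^T); first by rewrite Es.
  transitivity (u + time_integral (fun s => u *m (Phi s w)^T *m jacobian b (X s w)) s).
    exact: VE.
  apply: (congr1 (fun z => u + z)); apply: eq_time_integral => r /andP[r0 _].
  by rewrite (Es r r0).
have := HD _ _ _ _ _ _ (continuous_noise cB) Dy Dy' TV.
by rewrite yF'// (driven_path_flow b_C2 b_D2 cB Dy t0) [Num.max 0 t]max_r.
Qed.

End on_a_space.
End processes.

(** * Norms in L^p *)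

Section lp_norm.
Context {R : realType} {dO : measure_display} {Omega : measurableType dO}.
Context (P : probability Omega R) (p : R) (p1 : 1 <= p).
Implicit Types f g h : Omega -> R.
Local Open Scope ereal_scope.

Let p0 : (0 < p)%R := lt_le_trans ltr01 p1.

Definition pnorm f : \bar R := (\int[P]_w (f w `^ p)%:E) `^ p^-1.

Lemma pnorm_ge0 f : 0 <= pnorm f.
Proof. exact: poweR_ge0. Qed.

Lemma pnorm_powR f : pnorm f `^ p = \int[P]_w (f w `^ p)%:E.
Proof.
rewrite /pnorm -poweRrM mulVf ?gt_eqF// poweRe1//.
by apply: integral_ge0 => w _; rewrite lee_fin powR_ge0.
Qed.

Lemma poweR_le_cancel (x y : \bar R) : 0 <= x -> 0 <= y ->
  x `^ p <= y `^ p -> x <= y.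
Proof.
move=> x0 y0 xy; have := @gt0_ler_poweR _ p^-1 _ (x `^ p) (y `^ p).
rewrite !in_itv/= !leey !poweR_ge0 invr_ge0 (ltW p0) => /(_ isT isT isT xy).
by rewrite -!poweRrM mulfV ?gt_eqF// !poweRe1.
Qed.

Lemma poweR_le (x y : \bar R) : 0 <= x -> x <= y -> x `^ p <= y `^ p.
Proof.
move=> x0 xy; apply: gt0_ler_poweR => //; rewrite ?ltW// in_itv/= leey andbT//.
exact: le_trans xy.
Qed.

Lemma measurable_pow f : measurable_fun setT f ->
  measurable_fun setT (fun w => (f w `^ p)%:E).
Proof. by move=> mf; apply/measurable_EFinP; exact: (measurableT_comp (@measurable_powR R p) mf). Qed.

Lemma pnorm_Lnorm f : (forall w, 0 <= f w)%R -> pnorm f = 'N[P]_p%:E[EFin \o f].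
Proof.
move=> f0; rewrite unlock /pnorm; congr (_ `^ _); apply: eq_integral => w _.
by rewrite /= ger0_norm// poweR_EFin.
Qed.

Lemma pnorm_le f g : measurable_fun setT f -> measurable_fun setT g ->
  (forall w, 0 <= f w)%R -> {ae P, forall w, (f w <= g w)%R} -> pnorm f <= pnorm g.
Proof.
move=> mf mg f0 fg.
have i0 u : 0 <= \int[P]_w (u w `^ p)%:E.
  by apply: integral_ge0 => w _; rewrite lee_fin powR_ge0.
apply: gt0_ler_poweR; rewrite ?in_itv/= ?leey ?i0 ?invr_ge0 ?(ltW p0)//.
apply: ae_ge0_le_integral => //.
- by move=> w _; rewrite lee_fin powR_ge0.
- exact: measurable_pow.
- by move=> w _; rewrite lee_fin powR_ge0.
- exact: measurable_pow.
- apply: filterS fg => w fgw _; rewrite lee_fin ge0_ler_powR ?nnegrE ?(ltW p0)//.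
  exact: le_trans fgw.
Qed.

Lemma pnorm_triangle f g h : measurable_fun setT f -> measurable_fun setT g ->
  measurable_fun setT h -> (forall w, 0 <= f w)%R -> (forall w, 0 <= g w)%R ->
  (forall w, 0 <= h w)%R -> {ae P, forall w, (f w <= g w + h w)%R} ->
  pnorm f <= pnorm g + pnorm h.
Proof.
move=> mf mg mh f0 g0 h0 fgh.
apply: (le_trans (pnorm_le mf (measurable_funD mg mh) f0 fgh)).
rewrite !pnorm_Lnorm//; first exact: minkowski_EFin.
by move=> w; rewrite addr_ge0.
Qed.

Lemma pnorm_cst (c : R) : (0 <= c)%R -> pnorm (fun=> c) = c%:E.
Proof.
move=> c0; rewrite /pnorm integral_cst//.
rewrite [X in _ * X](probability_setT P) mule1 poweR_EFin.
by rewrite -powRrM mulfV ?gt_eqF// powRr1.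
Qed.

Lemma pnormZ (c : R) f : (0 <= c)%R -> measurable_fun setT f -> (forall w, 0 <= f w)%R ->
  pnorm (fun w => c * f w)%R = c%:E * pnorm f.
Proof.
move=> c0 mf f0; rewrite /pnorm.
under eq_integral do rewrite powRM// EFinM.
rewrite ge0_integralZl_EFin ?powR_ge0//; last 2 first.
- by move=> w _; rewrite lee_fin powR_ge0.
- exact: measurable_pow.
rewrite poweRM ?lee_fin ?powR_ge0//.
  by rewrite poweR_EFin -powRrM mulfV ?gt_eqF// powRr1.
by apply: integral_ge0 => w _; rewrite lee_fin powR_ge0.
Qed.

End lp_norm.

(** * Deterministic starting points *)

Lemma measurable_enorm (R : realType) (d : nat) (dT : measure_display)
    (T : measurableType dT) (Z : T -> 'rV[R]_d) :
  measurable_fun setT (Z : T -> borelE R d) ->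
  measurable_fun setT (fun w => enorm (Z w)).
Proof.
move=> mZ; have me : measurable_fun setT (@enorm R d : borelE R d -> R).
  apply: continuous_borel_measurable => x.
  apply: (@continuous_comp _ _ _ (fun t : 'rV[R]_d => dotp t t) (@Num.sqrt R)).
    by apply: continuous_dotp => y; exact: cvg_id.
  exact: sqrt_continuous.
exact: (measurableT_comp me mZ).
Qed.

(** Division by h = 2^-n followed by the limit in n removes the second-order
term. *)
Lemma lee_of_scaled (R : realType) (a : \bar R) (c D : R) : (0 <= a)%E ->
  (forall n, (2^-1 ^+ n)%:E * a <= (c * 2^-1 ^+ n + D * (2^-1 ^+ n) ^+ 2)%:E)%E ->
  (a <= c%:E)%E.
Proof.
move=> a0 H.
have afin : a \is a fin_num.
  rewrite ge0_fin_numE//; have := H 0%N; rewrite expr0 mul1e => /le_lt_trans; apply.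
  exact: ltry.
rewrite -(fineK afin) lee_fin; apply: (ler_cvg0 (cvg_geo_half D)) => n.
have := H n; rewrite -(fineK afin) -EFinM lee_fin.
have h0 : 0 < 2^-1 ^+ n :> R by rewrite exprn_gt0// invr_gt0.
by move=> {}H; rewrite -(ler_pM2l h0) mulrDr [_ * c]mulrC mulrCA -expr2.
Qed.

Lemma enorm_distD (R : realType) (d : nat) (v u w : 'rV[R]_d) :
  enorm (u - w) <= enorm (u - v) + enorm (v - w).
Proof. by rewrite -[X in enorm X](subrKA v) ler_enormD. Qed.

Section flow_and_tangent.
Context {R : realType} {d : nat} (hd : (0 < d)%N).
Context (b : 'rV[R]_d -> 'rV[R]_d) (sigma : 'M[R]_d).
Context (b_C2 : C2 b) (b_D2 : bounded_second_derivatives b)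
  (L : R) (L_gt0 : 0 < L) (b_lip : one_sided_lipschitz b L).
Context {dO : measure_display} {Omega : measurableType dO}.
Context (P : probability Omega R) (B : R -> Omega -> 'rV[R]_d).
Context (hB : standard_brownian_motion P B).
Context (p t : R) (p1 : 1 <= p) (t0 : 0 <= t).

Let cb : continuous b := drift_continuous b_C2.
Let p0 : 0 < p := lt_le_trans ltr01 p1.

Local Notation Fl x w := (flow b sigma t (B ^~ w) x).
Local Notation flow_gap x u := (pnorm P p (fun w => enorm (Fl (x + u) w - Fl x w))).

Lemma random_vector_flow x : random_vector (fun w => Fl x w).
Proof. by apply: measurable_flow_at => // s s0; exact: brownian_measurable hB s s0. Qed.

Lemma measurable_flow_gap x y : measurable_fun setT (fun w => enorm (Fl x w - Fl y w)).
Proof. by apply: measurable_enorm; apply: measurable_rowB; exact: random_vector_flow. Qed.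

Lemma flow_gap_le x u : (flow_gap x u <= (expR (L * t) * enorm u)%:E)%E.
Proof.
rewrite -(pnorm_cst P p1) ?mulr_ge0 ?expR_ge0 ?enorm_ge0//.
apply: (pnorm_le p1) => //; first exact: measurable_flow_gap.
  by move=> w; exact: enorm_ge0.
apply: filterS (brownian_continuous hB) => w cB.
have xu : x + u - x = u by rewrite addrAC subrr add0r.
have := flow_contract sigma b_C2 b_D2 L_gt0 b_lip (x + u) x cB t0.
by rewrite xu.
Qed.

Lemma measurable_tangent X Phi (u : 'rV[R]_d) : tangent_process P b X Phi ->
  measurable_fun setT (fun w => enorm (u *m (Phi t w)^T)).
Proof.
move=> [mPhi _]; apply: measurable_enorm; apply: measurable_rowP => j.
rewrite (_ : (fun w => _) = (fun w => \sum_i u 0 i * Phi t w j i)); last first.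
  by apply/funext => w; rewrite mxE; apply: eq_bigr => i _; rewrite [in LHS]mxE.
by apply: measurable_sum => i; apply: measurable_funM => //; exact: mPhi.
Qed.

(** In L^p, the tangent process and the increments of the flow differ by a
term of second order, uniformly in the starting point. *)
Lemma flow_gap_tangent : exists2 D : R, 0 <= D &
  forall (x u : 'rV[R]_d) X Phi, sde_solution P b sigma B X -> starts_at P X x ->
    tangent_process P b X Phi ->
    (flow_gap x u <= pnorm P p (fun w => enorm (u *m (Phi t w)^T)) + (D * enorm u ^+ 2)%:E)%E /\
    (pnorm P p (fun w => enorm (u *m (Phi t w)^T)) <= flow_gap x u + (D * enorm u ^+ 2)%:E)%E.
Proof.
have [D D0 HD] := tangent_estimate sigma b_C2 b_D2 L_gt0 b_lip hB t0.
exists D => // x u X Phi sX X0 TPhi.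
have Du0 : 0 <= D * enorm u ^+ 2 by rewrite mulr_ge0 ?sqr_ge0.
rewrite -(pnorm_cst P p1 Du0).
have aeD := HD x u X Phi sX X0 TPhi.
split; apply: (pnorm_triangle p1).
all: try (by move=> w; exact: enorm_ge0).
all: try exact: measurable_flow_gap.
all: try exact: (measurable_tangent u TPhi).
all: try exact: measurable_cst.
all: try (by move=> w; exact: Du0).
- apply: filterS aeD => w H.
  rewrite -[X in enorm X](subrK (u *m (Phi t w)^T)) (le_trans (ler_enormD _ _))//.
  by rewrite addrC lerD2l.
- apply: filterS aeD => w H.
  rewrite -[u *m _ in leLHS](subrK (Fl (x + u) w - Fl x w)) addrC.
  by rewrite (le_trans (ler_enormD _ _))// lerD2l enormBC.
Qed.

(** A linear bound on the increments of the flow in the direction v passes to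
the derivative of the flow. *)
Lemma unit_tangent_le (c : R) (x v : 'rV[R]_d) X Phi :
  (forall n, (flow_gap x (2^-1 ^+ n *: v) <= (c * 2^-1 ^+ n)%:E)%E) ->
  enorm v = 1 -> sde_solution P b sigma B X -> starts_at P X x ->
  tangent_process P b X Phi ->
  (pnorm P p (fun w => enorm (v *m (Phi t w)^T)) <= c%:E)%E.
Proof.
move=> Hc v1 sX X0 TPhi; have [D D0 HD] := flow_gap_tangent.
apply: (@lee_of_scaled _ _ c D); first exact: pnorm_ge0.
move=> n; have [_] := HD x (2^-1 ^+ n *: v) X Phi sX X0 TPhi.
have h0 : 0 <= 2^-1 ^+ n :> R by rewrite exprn_ge0// invr_ge0.
rewrite enormZ v1 mulr1 (ger0_norm h0).
rewrite (_ : (fun w => enorm _) = (fun w => 2^-1 ^+ n * enorm (v *m (Phi t w)^T))); last first.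
  by apply/funext => w; rewrite -scalemxAl enormZ (ger0_norm h0).
rewrite pnormZ//; [|exact: (measurable_tangent v TPhi)|by move=> w; exact: enorm_ge0].
by move=> /le_trans; apply; rewrite EFinD leeD2r.
Qed.

Local Notation K := (kappa P b sigma B p t).

(** The contraction estimate for the flow makes kappa finite, so that it can be
handled as a real number below. *)
Lemma kappa_le_exp : (K <= (expR (L * t))%:E)%E.
Proof.
apply: ub_ereal_sup => _ [x [v [X [Phi [v1 sX X0 TPhi ->]]]]].
apply: (unit_tangent_le _ v1 sX X0 TPhi) => n.
have := flow_gap_le x (2^-1 ^+ n *: v).
by rewrite enormZ v1 mulr1 ger0_norm// exprn_ge0// invr_ge0.
Qed.

Lemma exists_unit_vector : exists v : 'rV[R]_d, enorm v = 1.
Proof.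
exists (delta_mx 0 (Ordinal hd)); rewrite /enorm /dotp (bigD1 (Ordinal hd))//=.
rewrite mxE !eqxx mulr1 big1 ?addr0 ?sqrtr1// => i /negbTE ni.
by rewrite mxE ni andbF mulr0.
Qed.

Lemma tangent_le_kappa x v : enorm v = 1 ->
  (pnorm P p (fun w => enorm (v *m (flow_tangent b sigma B x t w)^T)) <= K)%E.
Proof.
move=> v1; apply: ereal_sup_ubound.
have [sX X0] := flow_solution sigma b_C2 b_D2 L_gt0 b_lip hB x.
have TX := tangent_process_exists sigma b_C2 b_D2 L_gt0 b_lip hB x.
exists x, v, (fun s w => flow b sigma s (B ^~ w) x), (flow_tangent b sigma B x).
split; [exact: v1|exact: sX|exact: X0|exact: TX|reflexivity].
Qed.

Lemma kappa_ge0 : (0 <= K)%E.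
Proof.
have [v v1] := exists_unit_vector.
exact: le_trans (pnorm_ge0 _ _ _) (tangent_le_kappa 0 v1).
Qed.

Lemma kappa_fin_num : K \is a fin_num.
Proof.
by rewrite ge0_fin_numE ?kappa_ge0// (le_lt_trans kappa_le_exp)// ltry.
Qed.

Lemma flow_gap_kappa1 : exists2 D : R, 0 <= D & forall x u : 'rV[R]_d,
  (flow_gap x u <= (fine K * enorm u + D * enorm u ^+ 2)%:E)%E.
Proof.
have [D D0 HD] := flow_gap_tangent; exists D => // x u.
have [->|u0] := pselect (u = 0).
  rewrite (_ : (fun w => _) = (fun w => 0 : R)); last first.
    by apply/funext => w; rewrite addr0 subrr enorm0.
  by rewrite pnorm_cst// lee_fin enorm0 expr0n/= !mulr0 addr0.
have [sX X0] := flow_solution sigma b_C2 b_D2 L_gt0 b_lip hB x.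
have TX := tangent_process_exists sigma b_C2 b_D2 L_gt0 b_lip hB x.
have [+ _] := HD x u _ _ sX X0 TX; move=> /le_trans; apply.
rewrite EFinD leeD2r//.
have eu := enorm_gt0 u0.
pose v := (enorm u)^-1 *: u.
have uE : u = enorm u *: v by rewrite /v scalerA mulfV ?scale1r// gt_eqF.
have v1 : enorm v = 1 by rewrite /v enormZ gtr0_norm ?invr_gt0// mulVf// gt_eqF.
rewrite (_ : (fun w => enorm _) = (fun w => enorm u * enorm (v *m (flow_tangent b sigma B x t w)^T))); last first.
  by apply/funext => w; rewrite [in LHS]uE -scalemxAl enormZ gtr0_norm.
rewrite pnormZ ?enorm_ge0//; last 2 first.
- exact: (measurable_tangent v TX).
- by move=> w; exact: enorm_ge0.
rewrite [fine K * _]mulrC EFinM lee_wpmul2l ?lee_fin ?enorm_ge0//.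
by rewrite fineK ?kappa_fin_num// tangent_le_kappa.
Qed.

(** Cutting the segment from x to x + u into n pieces reduces the second-order
error by a factor n, and so removes it in the limit. *)
Lemma flow_gap_kappa x u : (flow_gap x u <= (fine K * enorm u)%:E)%E.
Proof.
have [D D0 HD] := flow_gap_kappa1.
have step (v : 'rV[R]_d) n : (flow_gap x (n%:R *: v) <=
    (n%:R * (fine K * enorm v + D * enorm v ^+ 2))%:E)%E.
  elim: n => [|n IH].
    rewrite (_ : (fun w => _) = (fun w => 0 : R)); last first.
      by apply/funext => w; rewrite scale0r addr0 subrr enorm0.
    by rewrite pnorm_cst// mul0r.
  apply: (@le_trans _ _ (flow_gap (x + n%:R *: v) v + flow_gap x (n%:R *: v))%E).
    apply: (pnorm_triangle p1); try exact: measurable_flow_gap; try (by move=> w; exact: enorm_ge0).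
    apply: aeW => w; rewrite (_ : x + n.+1%:R *: v = x + n%:R *: v + v).
      exact: enorm_distD.
    by rewrite -natr1 scalerDl scale1r addrA.
  by rewrite -natr1 mulrDl mul1r [_ + (_ + _)]addrC EFinD; apply: leeD.
have gap0 := pnorm_ge0 P p (fun w => enorm (Fl (x + u) w - Fl x w)).
have gfin : flow_gap x u \is a fin_num.
  by rewrite ge0_fin_numE// (le_lt_trans (flow_gap_le x u))// ltry.
rewrite -(fineK gfin) lee_fin.
have cv : D * enorm u ^+ 2 * n.+1%:R^-1 @[n --> \oo] --> 0.
  rewrite -[X in _ --> X](mulr0 (D * enorm u ^+ 2)).
  by apply: cvgM; [exact: cvg_cst|exact: cvg_harmonic].
apply: (ler_cvg0 cv) => n; rewrite -lee_fin fineK//.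
have n0 : n.+1%:R != 0 :> R by [].
have := step (n.+1%:R^-1 *: u) n.+1.
rewrite scalerA mulfV// scale1r => /le_trans; apply; rewrite lee_fin.
rewrite enormZ ger0_norm ?invr_ge0// le_eqVlt; apply/orP; left; apply/eqP.
by field.
Qed.

Lemma moment_flow_gap x y :
  (moment P p (fun w => Fl x w - Fl y w)%R <= K `^ p * (enorm (x - y) `^ p)%:E)%E.
Proof.
have := flow_gap_kappa y (x - y); rewrite addrC subrK => H.
rewrite /moment -(pnorm_powR P p1) -poweR_EFin -poweRM ?kappa_ge0 ?lee_fin ?enorm_ge0//.
apply: (poweR_le p1) => //; first exact: pnorm_ge0.
by rewrite (le_trans H)// EFinM fineK ?kappa_fin_num.
Qed.

(** The bound of the increments of the flow by kappa gives one inequality, and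
differentiation of the increments gives the other. *)
Lemma kappa_coupling_sup : (K `^ p = coupling_sup P b sigma B p t)%E.
Proof.
set S := coupling_sup P b sigma B p t.
have KE := fineK kappa_fin_num.
have gap_S x y : x <> y ->
    (moment P p (fun w => Fl x w - Fl y w)%R / (enorm (x - y) `^ p)%:E <= S)%E.
  move=> xy; apply: ereal_sup_ubound.
  have [sX X0] := flow_solution sigma b_C2 b_D2 L_gt0 b_lip hB x.
  have [sY Y0] := flow_solution sigma b_C2 b_D2 L_gt0 b_lip hB y.
  exists x, y, (fun s w => flow b sigma s (B ^~ w) x), (fun s w => flow b sigma s (B ^~ w) y).
  by split; [exact: xy|split; [exact: sX|exact: X0]|split; [exact: sY|exact: Y0]|].
have e_gt0 (x y : 'rV[R]_d) : x <> y -> 0 < enorm (x - y) `^ p.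
  by move=> xy; rewrite powR_gt0// enorm_gt0// => /subr0_eq.
have SK : (S <= K `^ p)%E.
  apply: ub_ereal_sup => _ [x [y [X [Y [xy [sX X0] [sY Y0] ->]]]]].
  have -> : moment P p (fun w => X t w - Y t w)%R = moment P p (fun w => Fl x w - Fl y w)%R.
    apply: ge0_ae_eq_integral => //.
    - apply: measurable_pow => //; apply: measurable_enorm; apply: measurable_rowB.
        by have [mX _] := sX; exact: mX.
      by have [mY _] := sY; exact: mY.
    - by apply: measurable_pow => //; exact: measurable_flow_gap.
    - by move=> w _; rewrite lee_fin powR_ge0.
    - by move=> w _; rewrite lee_fin powR_ge0.
    - have XF : {ae P, forall w, X t w = Fl x w}.
        by apply: filterS2 X0 (solution_flow b_C2 b_D2 hB sX) => w <-; apply.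
      have YF : {ae P, forall w, Y t w = Fl y w}.
        by apply: filterS2 Y0 (solution_flow b_C2 b_D2 hB sY) => w <-; apply.
      by apply: filterS2 XF YF => w Xw Yw _; rewrite Xw Yw.
  rewrite inver gt_eqF ?e_gt0// lee_pdivrMr ?e_gt0//.
  exact: moment_flow_gap.
have S0 : (0 <= S)%E.
  have [v v1] := exists_unit_vector.
  have v0 : v <> 0 by move=> v0; move: v1; rewrite v0 enorm0 => /eqP; rewrite eq_sym oner_eq0.
  apply: le_trans (gap_S v 0 v0); rewrite mule_ge0//.
    by apply: integral_ge0 => w _; rewrite lee_fin powR_ge0.
  by rewrite inve_ge0 lee_fin powR_ge0.
have Sfin : S \is a fin_num.
  by rewrite ge0_fin_numE// (le_lt_trans SK)// poweR_lty// -KE ltry.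
apply/eqP; rewrite eq_le SK andbT.
have -> : S = ((S `^ p^-1) `^ p)%E by rewrite -poweRrM mulVf ?gt_eqF// poweRe1.
apply: (poweR_le p1); first exact: kappa_ge0.
have SE : (S `^ p^-1 = (fine S `^ p^-1)%:E)%E by rewrite -poweR_EFin fineK.
rewrite SE; apply: ub_ereal_sup => _ [x [v [X [Phi [v1 sX X0 TPhi ->]]]]].
apply: (unit_tangent_le _ v1 sX X0 TPhi) => n.
set u := 2^-1 ^+ n *: v.
have h0 : 0 < 2^-1 ^+ n :> R by rewrite exprn_gt0// invr_gt0.
have eu : enorm u = 2^-1 ^+ n by rewrite /u enormZ v1 mulr1 gtr0_norm.
have xu : x + u <> x.
  by move=> /(canRL (addKr _)); rewrite addNr => u0; move: eu; rewrite u0 enorm0 => /eqP; rewrite lt_eqF.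
apply: (poweR_le_cancel p1); first exact: pnorm_ge0.
  by rewrite lee_fin mulr_ge0 ?powR_ge0// ltW.
rewrite (pnorm_powR P p1) poweR_EFin powRM ?powR_ge0 ?(ltW h0)//.
rewrite -powRrM mulVf ?gt_eqF// powRr1 ?fine_ge0// EFinM fineK//.
have := gap_S _ _ xu; rewrite addrAC subrr add0r eu.
rewrite inver gt_eqF ?powR_gt0// lee_pdivrMr ?powR_gt0//.
Qed.

End flow_and_tangent.

(** * Random starting points *)

Section product_probability.
Context {R : realType} {d1 d2 : measure_display}.
Context {T1 : measurableType d1} {T2 : measurableType d2}.
Context (P1 : probability T1 R) (P2 : probability T2 R).

Let prod_setT : (P1 \x P2)%E setT = 1%E.
Proof.
rewrite -setXTT product_measure1E//.
by rewrite [X in (X * _)%E](probability_setT P1) [X in (_ * X)%E](probability_setT P2) mule1.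
Qed.

HB.instance Definition _ :=
  Measure_isProbability.Build _ _ _ (P1 \x P2)%E prod_setT.

Definition product_probability : probability (T1 * T2)%type R := (P1 \x P2)%E.

End product_probability.

Section independent_noise.
Context {R : realType} {d : nat} {dO : measure_display} {Omega : measurableType dO}.
Context (P : probability Omega R) (B : R -> Omega -> 'rV[R]_d).

Definition noise_events (D : set R) : set (set Omega) :=
  [set E | exists s, exists A : set (borelE R d),
     [/\ D s, measurable A & E = B s @^-1` A] ].

(** The probability space seen through the process B on the time set D: its
measurable sets are those of sigma_process B D. *)
Definition noise_space (D : set R) := g_sigma_algebraType (noise_events D).

Lemma measurable_noise D s : D s ->
  measurable_fun setT (B s : noise_space D -> borelE R d).
Proof.
move=> Ds _ A mA; rewrite setTI; apply: sub_sigma_algebra.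
by exists s, A.
Qed.

Lemma measurable_noise_id D :
  (forall s, D s -> random_vector (B s)) ->
  measurable_fun setT ((fun w => w) : Omega -> noise_space D).
Proof.
move=> mB; apply: (@measurability _ _ Omega (noise_space D) setT _ (noise_events D)) => //.
move=> _ [_ [s [A [Ds mA ->]]] <-]; rewrite setTI.
by rewrite -[X in measurable X]setTI; exact: mB.
Qed.

Context {d1 : measure_display} {T : measurableType d1} (Z : Omega -> T).
Context (mZ : measurable_fun setT Z).
Context (mB : forall s, 0 <= s -> random_vector (B s)).
Context (indZ : independent_of_process P Z B).

(** Independence lets the starting point be frozen. Only functions of w that
are measurable for the noise are allowed, since Z may be correlated with the
rest of the probability space. *)
Lemma integral_freeze (f : T * noise_space `[0, +oo[ -> \bar R) :
  measurable_fun setT f -> (forall z, 0 <= f z)%E ->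
  (\int[P]_w f (Z w, w) = \int[law P mZ]_z \int[P]_w f (z, w))%E.
Proof.
move=> mf f0.
have mid : measurable_fun setT ((fun w => w) : Omega -> noise_space `[0, +oo[).
  by apply: measurable_noise_id => s; rewrite /= in_itv/= andbT; exact: mB.
have -> : (\int[P]_w f (Z w, w) = \int[law P (measurable_fun_pair mZ mid)]_z f z)%E.
  by rewrite integral_law.
rewrite (eq_measure_integral (law P mZ \x law P mid)%E); last first.
  move=> C mC _; apply: (independent_joint_law mZ mid _ mC) => A E mA mE.
  by apply: indZ; [exists A|exact: mE].
rewrite fubini_tonelli1//; apply: eq_integral => z _.
rewrite /fubini_F integral_law//.
exact: measurableT_comp.
Qed.

End independent_noise.

Section random_starting_points.
Context {R : realType} {d : nat} (hd : (0 < d)%N).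
Context (b : 'rV[R]_d -> 'rV[R]_d) (sigma : 'M[R]_d).
Context (b_C2 : C2 b) (b_D2 : bounded_second_derivatives b)
  (L : R) (L_gt0 : 0 < L) (b_lip : one_sided_lipschitz b L).
Context {dO : measure_display} {Omega : measurableType dO}.
Context (P : probability Omega R) (B : R -> Omega -> 'rV[R]_d).
Context (hB : standard_brownian_motion P B).
Context (p t : R) (p1 : 1 <= p) (t0 : 0 <= t).

Let cb : continuous b := drift_continuous b_C2.

Local Notation Fl x w := (flow b sigma t (B ^~ w) x).
Local Notation K := (kappa P b sigma B p t).

Section gap.
Context {dT : measure_display} {T : measurableType dT} (C : R -> T -> 'rV[R]_d).
Context (mC : forall s, 0 <= s -> measurable_fun setT (C s : T -> borelE R d)).

Lemma measurable_pair_flow :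
  measurable_fun setT ((fun q => (flow b sigma t (C ^~ q.2) q.1.1, flow b sigma t (C ^~ q.2) q.1.2)) :
    (borelE R d * borelE R d) * T -> (borelE R d * borelE R d)%type).
Proof.
have mF := measurable_flow sigma cb t0 mC.
have m1 : measurable_fun setT ((fun q => (q.1.1, q.2)) :
    (borelE R d * borelE R d) * T -> (borelE R d * T)%type).
  by apply: measurable_fun_pair => //; exact: measurableT_comp.
have m2 : measurable_fun setT ((fun q => (q.1.2, q.2)) :
    (borelE R d * borelE R d) * T -> (borelE R d * T)%type).
  by apply: measurable_fun_pair => //; exact: measurableT_comp.
by apply: measurable_fun_pair; [exact: (measurableT_comp mF m1)|exact: (measurableT_comp mF m2)].
Qed.

Lemma measurable_distance_pow :
  measurable_fun setT ((fun z => (enorm ((z.1 : 'rV[R]_d) - (z.2 : 'rV[R]_d)) `^ p)%:E) :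
    (borelE R d * borelE R d)%type -> \bar R).
Proof.
apply: measurable_pow; apply: measurable_enorm.
by apply: (@measurable_rowB _ _ _ (borelE R d * borelE R d)%type fst snd).
Qed.

End gap.

(** Once the starting points are frozen, the bound for deterministic starting
points applies under the integral. *)
Lemma coupling_moment (X Y : R -> Omega -> 'rV[R]_d) :
  sde_solution P b sigma B X -> sde_solution P b sigma B Y ->
  independent_of_process P
    ((fun w => (X 0 w, Y 0 w)) : Omega -> (borelE R d * borelE R d)%type) B ->
  (moment P p (fun w => (X t w - Y t w)%R) <=
     K `^ p * moment P p (fun w => (X 0 w - Y 0 w)%R))%E.
Proof.
move=> sX sY ind.
have [mX _] := sX; have [mY _] := sY.
pose Z : Omega -> (borelE R d * borelE R d)%type := fun w => (X 0 w, Y 0 w).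
have mZ : measurable_fun setT Z.
  by apply: measurable_fun_pair; [exact: mX|exact: mY].
have mN s : 0 <= s -> measurable_fun setT (B s : noise_space B `[0, +oo[ -> borelE R d).
  by move=> s0; apply: measurable_noise; rewrite /= in_itv/= s0.
pose f : (borelE R d * borelE R d) * noise_space B `[0, +oo[ -> \bar R :=
  fun q => (enorm (Fl q.1.1 q.2 - Fl q.1.2 q.2) `^ p)%:E.
have mf : measurable_fun setT f.
  exact: (measurableT_comp measurable_distance_pow (measurable_pair_flow mN)).
have f0 q : (0 <= f q)%E by rewrite lee_fin powR_ge0.
have mBO s : 0 <= s -> random_vector (B s) := @brownian_measurable _ _ _ _ _ _ hB s.
have -> : moment P p (fun w => (X t w - Y t w)%R) = (\int[P]_w f (Z w, w))%E.
  have XF := solution_flow b_C2 b_D2 hB sX.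
  have YF := solution_flow b_C2 b_D2 hB sY.
  have mBid : measurable_fun setT ((fun w => w) : Omega -> noise_space B `[0, +oo[).
    by apply: measurable_noise_id => s; rewrite /= in_itv/= andbT; exact: mBO.
  apply: ge0_ae_eq_integral.
  - exact: measurableT.
  - apply: measurable_pow; apply: measurable_enorm; apply: measurable_rowB.
      exact: mX.
    exact: mY.
  - exact: (measurableT_comp mf (measurable_fun_pair mZ mBid)).
  - by move=> w _; rewrite lee_fin powR_ge0.
  - by move=> w _; exact: f0.
  - by apply: filterS2 XF YF => w Xw Yw _; rewrite (Xw t t0) (Yw t t0).
rewrite (integral_freeze mZ mBO ind mf f0).
have D0 (z : (borelE R d * borelE R d)%type) :
    (0 <= (enorm ((z.1 : 'rV[R]_d) - (z.2 : 'rV[R]_d)) `^ p)%:E)%E.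
  by rewrite lee_fin powR_ge0.
have -> : moment P p (fun w => (X 0 w - Y 0 w)%R) =
    (\int[law P mZ]_z (enorm ((z.1 : 'rV[R]_d) - (z.2 : 'rV[R]_d)) `^ p)%:E)%E.
  by rewrite (integral_law P mZ measurable_distance_pow D0).
rewrite -(ge0_integralZl _ measurableT measurable_distance_pow (fun z _ => D0 z) (poweR_ge0 _ _)).
apply: ge0_le_integral.
- exact: measurableT.
- by move=> z _; apply: integral_ge0 => w _; exact: f0.
- pose g : (borelE R d * borelE R d) * Omega -> \bar R :=
    fun q => (enorm (Fl q.1.1 q.2 - Fl q.1.2 q.2) `^ p)%:E.
  have mg : measurable_fun setT g.
    exact: (measurableT_comp measurable_distance_pow (measurable_pair_flow mBO)).
  have g0 q : (0 <= g q)%E by rewrite lee_fin powR_ge0.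
  have H := @measurable_fun_fubini_tonelli_F _ _ _ _ _ P g mg g0.
  exact: H.
- by apply: measurable_funeM; exact: measurable_distance_pow.
- move=> [x y] _; exact: (moment_flow_gap hd sigma b_C2 b_D2 L_gt0 b_lip hB p1 t0 x y).
Qed.

End random_starting_points.

(** * Uniqueness in law *)

Section continuous_test_functions.
Context {R : realType} {d : nat}.

Definition test_function (g : 'rV[R]_d -> R) : Prop :=
  continuous g /\ forall x, 0 <= g x <= 1.

Lemma test_dominated_convergence (dT : measure_display) (T : measurableType dT)
    (P : probability T R) (f_ : nat -> T -> R) (f : T -> R) :
  (forall n, measurable_fun setT (f_ n)) -> measurable_fun setT f ->
  (forall n w, 0 <= f_ n w <= 1) ->
  {ae P, forall w, f_ n w @[n --> \oo] --> f w} ->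
  (\int[P]_w (f_ n w)%:E)%E @[n --> \oo] --> (\int[P]_w (f w)%:E)%E.
Proof.
move=> mf_ mf f01 ff.
have ig : P.-integrable setT (fun=> 1%E : \bar R).
  apply/integrableP; split; first exact: measurable_cst.
  under eq_integral do rewrite abse1.
  by rewrite integral_cst// mul1e (le_lt_trans (probability_le1 _ _))// ltry.
have [//| | | |_ _ H] := @dominated_convergence _ _ _ P setT measurableT
  (fun n w => (f_ n w)%:E) (fun w => (f w)%:E) (fun=> 1%E) _ _ _ ig _.
- by move=> n; apply/measurable_EFinP.
- by apply/measurable_EFinP.
- by apply: filterS ff => w fw _; apply: cvg_EFin => //; exact: nearW.
- apply: aeW => w n _; have /andP[f0 f1] := f01 n w.
  by rewrite abse_EFin ger0_norm// lee_fin.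
exact: H.
Qed.

(** A continuous approximation of the indicator of the orthant from below. *)
Definition ramp (a : 'I_d -> R) (j : nat) (x : 'rV[R]_d) : R :=
  \prod_i Num.min 1 (j%:R * Num.max 0 (a i - x 0 i)).

Lemma ramp_test a j : test_function (ramp a j).
Proof.
split=> [x|x].
  apply: (@cvg_big R 'I_d *%R 1 predT (@mul_continuous R) 'rV[R]_d (nbhs x) _
    (fun i y => Num.min 1 (j%:R * Num.max 0 (a i - y 0 i)))) => i _.
  have c0 : continuous (fun c : R => a i - c).
    by move=> c; apply: cvgB; [exact: cvg_cst|exact: cvg_id].
  have c1 : continuous (fun c : R => Num.max 0 (a i - c)).
    by move=> c; apply: (@continuous_max R R (fun=> 0) _ c (cvg_cst _)); exact: c0.
  have c2 : continuous (fun c : R => j%:R * Num.max 0 (a i - c)).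
    by move=> c; apply: cvgM; [exact: cvg_cst|exact: c1].
  have c3 : continuous (fun c : R => Num.min 1 (j%:R * Num.max 0 (a i - c))).
    by move=> c; apply: (@continuous_min R R (fun=> 1) _ c (cvg_cst _)); exact: c2.
  exact: (continuous_comp (@coord_continuous R 1 d 0 i x) (c3 (x 0 i))).
have H i : 0 <= Num.min 1 (j%:R * Num.max 0 (a i - x 0 i)) <= 1.
  by rewrite le_min ler01 ge_min lexx mulr_ge0// le_max lexx.
rewrite prodr_ge0 => [|i _]; last by have /andP[] := H i.
apply: (@le_trans _ _ (\prod_(i < d) 1)); last by rewrite big1.
by apply: ler_prod => i _; exact: H.
Qed.

Lemma ramp_cvg a x : ramp a j x @[j --> \oo] --> (\1_(orthant a) x : R).
Proof.
rewrite indicE; have [xa|] := boolP (x \in orthant a).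
  have -> : true%:R = \prod_(i < d) 1 :> R by rewrite big1.
  apply: cvg_big => [|i _]; first exact: mul_continuous.
  apply: cvg_near_cst; move: xa; rewrite inE => /(_ i) xai.
  have c0 : 0 < a i - x 0 i by rewrite subr_gt0.
  near=> j; apply: min_l; rewrite (max_r (ltW c0)) -ler_pdivrMr// div1r.
  by near: j; exact: nbhs_infty_ger.
rewrite notin_setE => /existsNP[i /negP]; rewrite -leNgt => xai.
apply: cvg_near_cst; apply: nearW => j /=.
by rewrite /ramp (bigD1 i)//= max_l ?subr_le0// mulr0 min_r// mul0r.
Unshelve. all: by end_near.
Qed.

(** Continuous functions with values in the unit interval determine a
probability on the Borel sets, because the indicator of an orthant is a limit
of such functions. *)
Lemma test_measure_unique (P Q : probability (borelE R d) R) :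
  (forall g, test_function g -> (\int[P]_x (g x)%:E = \int[Q]_x (g x)%:E)%E) ->
  forall A, measurable A -> P A = Q A.
Proof.
move=> PQ; apply: orthant_measure_unique => a.
have mO : measurable (orthant a : set (borelE R d)).
  by rewrite borel_orthants; apply: sub_sigma_algebra; exists a.
have H (m : probability (borelE R d) R) :
    (\int[m]_x (ramp a j x)%:E)%E @[j --> \oo] --> m (orthant a).
  have -> : m (orthant a) = (\int[m]_x (\1_(orthant a) x)%:E)%E.
    by rewrite integral_indic// setIT.
  apply: test_dominated_convergence.
  - by move=> j; apply: continuous_borel_measurable; have [] := ramp_test a j.
  - exact: measurable_indic.
  - by move=> j x; have [_] := ramp_test a j; apply.
  - by apply: aeW => x; exact: ramp_cvg.
apply: (cvg_unique _ (H P)) => //; rewrite (_ : (fun j => _) = (fun j => \int[Q]_x (ramp a j x)%:E)%E).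
  exact: H.
by apply/funext => j; apply: PQ; exact: ramp_test.
Qed.

End continuous_test_functions.

Section euler_independence.
Context {R : realType} {d : nat}.
Context (b : 'rV[R]_d -> 'rV[R]_d) (sigma : 'M[R]_d) (cb : continuous b).
Context {dO : measure_display} {Omega : measurableType dO}.
Context (P : probability Omega R) (B : R -> Omega -> 'rV[R]_d).
Context (hB : standard_brownian_motion P B).

Lemma measurable_euler_position (x : 'rV[R]_d) (h : R) n : 0 <= h ->
  measurable_fun setT ((fun w => euler_path b sigma (B ^~ w) x h n) : Omega -> borelE R d).
Proof.
move=> h0; have m := @measurable_euler_path R d b sigma cb _ Omega B h n
  (fun k _ => brownian_measurable hB (mulr_ge0 (ler0n _ k) h0)).
exact: (measurableT_comp m (pair1_measurable (x : borelE R d))).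
Qed.

(** The first n steps of the scheme use the noise up to time n h only. *)
Lemma euler_independence (x : 'rV[R]_d) (h : R) n (A A' : set (borelE R d)) :
  0 < h -> measurable A -> measurable A' ->
  P ((fun w => euler_path b sigma (B ^~ w) x h n) @^-1` A `&`
     (fun w => B (n.+1%:R * h) w - B (n%:R * h) w) @^-1` A') =
  (P ((fun w => euler_path b sigma (B ^~ w) x h n) @^-1` A) *
   P ((fun w => B (n.+1%:R * h) w - B (n%:R * h) w)%R @^-1` A'))%E.
Proof.
move=> h0 mA mA'; have [_ _ _ _ ind] := hB.
have nh0 : 0 <= n%:R * h by rewrite mulr_ge0// ltW.
have nh : n%:R * h < n.+1%:R * h by rewrite ltr_pM2r// ltr_nat.
rewrite setIC muleC; apply: (ind _ _ nh0 nh); first by exists A'.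
have m := @measurable_euler_path R d b sigma cb _ (noise_space B `[0, n%:R * h]) B h n.
have {}m := m _; have mn : measurable_fun setT
    ((fun w => euler_path b sigma (B ^~ w) x h n) : noise_space B `[0, n%:R * h] -> borelE R d).
  apply: (measurableT_comp (m _) (pair1_measurable (x : borelE R d))) => k kn.
  apply: measurable_noise; rewrite /= in_itv/= mulr_ge0 ?(ltW h0)//=.
  by rewrite ler_pM2r// ler_nat.
by have := mn measurableT A mA; rewrite setTI.
Qed.

End euler_independence.

Section uniqueness_in_law.
Context {R : realType} {d : nat}.
Context (b : 'rV[R]_d -> 'rV[R]_d) (sigma : 'M[R]_d).
Context (b_C2 : C2 b) (b_D2 : bounded_second_derivatives b)
  (L : R) (L_gt0 : 0 < L) (b_lip : one_sided_lipschitz b L).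
Let cb : continuous b := drift_continuous b_C2.

Lemma flow_cvg (beta : R -> 'rV[R]_d) x (t : R) : continuous_path beta -> 0 <= t ->
  euler_path b sigma beta x (t / n.+1%:R) n.+1 @[n --> \oo] --> flow b sigma t beta x.
Proof.
move=> cbeta t0; have [y Dy <-//] := flow_driven sigma b_C2 b_D2 L_gt0 b_lip x cbeta.
have H := euler_cvg b_C2 b_D2 (continuous_noise cbeta) (noise0 sigma beta) Dy t0.
apply: cvg_trans H; apply: near_eq_cvg; apply: nearW => n.
by rewrite euler_pathE// divr_ge0.
Qed.

Lemma euler_path_step0 (beta : R -> 'rV[R]_d) x n : euler_path b sigma beta x 0 n = x.
Proof.
elim: n => [//|n IH]; rewrite /euler_path /= -/(euler_path b sigma beta x 0 n).
by rewrite IH !mulr0 subrr mul0mx scale0r !addr0.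
Qed.

Context {d1 d2 : measure_display} {O1 : measurableType d1} {O2 : measurableType d2}.
Context (P1 : probability O1 R) (P2 : probability O2 R).
Context (B1 : R -> O1 -> 'rV[R]_d) (B2 : R -> O2 -> 'rV[R]_d).
Context (hB1 : standard_brownian_motion P1 B1) (hB2 : standard_brownian_motion P2 B2).

(** The law of an increment is prescribed on products of measurable subsets of the
line only; the orthants are such products. *)
Lemma increment_law (r s : R) : 0 <= r -> r < s ->
  forall A : set (borelE R d), measurable A ->
  P1 ((fun w => B1 s w - B1 r w) @^-1` A) = P2 ((fun w => B2 s w - B2 r w) @^-1` A).
Proof.
move=> r0 rs; have s0 : 0 <= s by rewrite (le_trans r0)// ltW.
have m1 : measurable_fun setT ((fun w => B1 s w - B1 r w) : O1 -> borelE R d).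
  by apply: measurable_rowB; exact: (brownian_measurable hB1).
have m2 : measurable_fun setT ((fun w => B2 s w - B2 r w) : O2 -> borelE R d).
  by apply: measurable_rowB; exact: (brownian_measurable hB2).
apply: (@orthant_measure_unique R d (law P1 m1) (law P2 m2)) => a.
have [_ _ _ G1 _] := hB1; have [_ _ _ G2 _] := hB2.
have E (T : Type) (Z : T -> 'rV[R]_d) :
    Z @^-1` orthant a = [set w | forall i, [set` `]-oo, a i[] (Z w 0 i)].
  by apply/seteqP; split => w wa i; have := wa i; rewrite /= in_itv.
transitivity (P1 [set w | forall i, [set` `]-oo, a i[] ((B1 s w - B1 r w) 0 i)]).
  exact: (congr1 P1 (E O1 (fun w => B1 s w - B1 r w))).
transitivity (P2 [set w | forall i, [set` `]-oo, a i[] ((B2 s w - B2 r w) 0 i)]); last first.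
  exact: (congr1 P2 (esym (E O2 (fun w => B2 s w - B2 r w)))).
have mI i : measurable [set` `]-oo, a i[] by exact: measurable_itv.
transitivity (\big[*%E/1%E]_(i < d) normal_prob 0 (Num.sqrt (s - r)) [set` `]-oo, a i[]).
  exact: (G1 r s r0 rs _ mI).
exact/esym/(G2 r s r0 rs _ mI).
Qed.

(** The next position is a function of the present one and of an independent
increment, and independence reduces their joint law to the two marginals. *)
Lemma euler_law (x : 'rV[R]_d) (h : R) n : 0 < h ->
  forall A : set (borelE R d), measurable A ->
  P1 ((fun w => euler_path b sigma (B1 ^~ w) x h n) @^-1` A) =
  P2 ((fun w => euler_path b sigma (B2 ^~ w) x h n) @^-1` A).
Proof.
move=> h0; elim: n => [|n IH] A mA.
  have [Ax|nAx] := pselect (A x).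
    transitivity (1%E : \bar R); last symmetry.
      by rewrite -(probability_setT P1); congr (P1 _); apply/seteqP; split.
    by rewrite -(probability_setT P2); congr (P2 _); apply/seteqP; split.
  transitivity (0%E : \bar R); last symmetry.
    by rewrite -(measure0 P1); congr (P1 _); apply/seteqP; split.
  by rewrite -(measure0 P2); congr (P2 _); apply/seteqP; split.
have h0' := ltW h0.
have nh0 : 0 <= n%:R * h by rewrite mulr_ge0.
have nh : n%:R * h < n.+1%:R * h by rewrite ltr_pM2r// ltr_nat.
have nh1 : 0 <= n.+1%:R * h by rewrite mulr_ge0.
have mY1 := measurable_euler_position sigma cb hB1 x n h0'.
have mY2 := measurable_euler_position sigma cb hB2 x n h0'.
have mI1 : measurable_fun setT ((fun w => B1 (n.+1%:R * h) w - B1 (n%:R * h) w) : O1 -> borelE R d).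
  by apply: measurable_rowB; exact: (brownian_measurable hB1).
have mI2 : measurable_fun setT ((fun w => B2 (n.+1%:R * h) w - B2 (n%:R * h) w) : O2 -> borelE R d).
  by apply: measurable_rowB; exact: (brownian_measurable hB2).
pose G (z : (borelE R d * borelE R d)%type) : borelE R d :=
  (z.1 : 'rV[R]_d) + h *: b z.1 + (z.2 : 'rV[R]_d) *m sigma^T.
have mG : measurable_fun setT G.
  apply: (@measurable_rowD R d _ (borelE R d * borelE R d)%type (fun z => (z.1 : 'rV[R]_d) + h *: b z.1)).
    apply: (@measurable_rowD R d _ (borelE R d * borelE R d)%type fst) => //.
    apply: (@measurable_rowZ R d _ (borelE R d * borelE R d)%type).
    exact: (measurableT_comp (continuous_borel_measurable_row cb) measurable_fst).
  exact: (@measurable_mulmx R d _ (borelE R d * borelE R d)%type snd).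
have mGA : measurable (G @^-1` A) by have := mG measurableT A mA; rewrite setTI.
have rect (C C' : set (borelE R d)) : measurable C -> measurable C' ->
    law P1 (measurable_fun_pair mY1 mI1) (C `*` C') =
    law P2 (measurable_fun_pair mY2 mI2) (C `*` C').
  move=> mC mC'.
  transitivity (P1 ((fun w => euler_path b sigma (B1 ^~ w) x h n) @^-1` C) *
   P1 ((fun w => B1 (n.+1%:R * h) w - B1 (n%:R * h) w)%R @^-1` C'))%E.
    exact: (euler_independence sigma cb hB1 x n h0 mC mC').
  rewrite IH// (increment_law nh0 nh mC').
  exact/esym/(euler_independence sigma cb hB2 x n h0 mC mC').
exact: (rectangle_measure_unique rect mGA).
Qed.

(** Uniqueness in law: it holds for each Euler scheme and passes to the limit,
since the schemes converge almost surely. *)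
Lemma flow_law (t : R) (x : 'rV[R]_d) : 0 <= t ->
  forall A : set (borelE R d), measurable A ->
  P1 ((fun w => flow b sigma t (B1 ^~ w) x) @^-1` A) =
  P2 ((fun w => flow b sigma t (B2 ^~ w) x) @^-1` A).
Proof.
move=> t0; have m1 := measurable_flow_at sigma cb x t0 (@brownian_measurable _ _ _ _ _ _ hB1).
have m2 := measurable_flow_at sigma cb x t0 (@brownian_measurable _ _ _ _ _ _ hB2).
apply: (@test_measure_unique R d (law P1 m1) (law P2 m2)) => g [cg g01].
have mg := continuous_borel_measurable cg.
have mgE : measurable_fun setT (fun x : borelE R d => (g x)%:E) by apply/measurable_EFinP.
have g0 y : (0 <= (g y)%:E)%E by rewrite lee_fin; have /andP[] := g01 y.
rewrite (integral_law P1 m1 mgE g0) (integral_law P2 m2 mgE g0).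
have cvgE (dO : measure_display) (O : measurableType dO) (P : probability O R) (B : R -> O -> 'rV[R]_d)
    (hB : standard_brownian_motion P B) (m : measurable_fun setT ((fun w => flow b sigma t (B ^~ w) x) : O -> borelE R d)) :
    (\int[P]_w (g (euler_path b sigma (B ^~ w) x (t / n.+1%:R) n.+1))%:E)%E @[n --> \oo] -->
    (\int[P]_w (g (flow b sigma t (B ^~ w) x))%:E)%E.
  apply: test_dominated_convergence.
  - move=> n; apply: (measurableT_comp mg).
    by apply: (measurable_euler_position sigma cb hB); rewrite divr_ge0.
  - exact: (measurableT_comp mg m).
  - by move=> n w; exact: g01.
  - apply: filterS (brownian_continuous hB) => w cB.
    exact: (cvg_comp _ _ (flow_cvg (x := x) cB t0) (cg _)).
apply: (cvg_unique _ (cvgE _ _ _ _ hB1 m1)) => //.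
rewrite (_ : (fun n => _) = (fun n => \int[P2]_w (g (euler_path b sigma (B2 ^~ w) x (t / n.+1%:R) n.+1))%:E)%E).
  exact: cvgE hB2 m2.
apply/funext => n; have [->|tn0] := eqVneq t 0.
  have E0 (beta : R -> 'rV[R]_d) : euler_path b sigma beta x (0 / n.+1%:R) n.+1 = x.
    by rewrite mul0r euler_path_step0.
  under eq_integral do rewrite E0.
  under [RHS]eq_integral do rewrite E0.
  by rewrite !integral_cst// [X in (_ * X)%E](probability_setT P1) [X in _ = (_ * X)%E](probability_setT P2).
have h0 : 0 < t / n.+1%:R by rewrite divr_gt0// lt_neqAle eq_sym tn0.
have y1 := measurable_euler_position sigma cb hB1 x n.+1 (ltW h0).
have y2 := measurable_euler_position sigma cb hB2 x n.+1 (ltW h0).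
rewrite -(integral_law P1 y1 mgE g0) -(integral_law P2 y2 mgE g0).
by apply: integral_eq_measure => A mA; exact: euler_law.
Qed.

End uniqueness_in_law.

(** * Contraction of the Wasserstein distance *)

Lemma probability_preimage (R : realType) (d1 d2 : measure_display)
    (T1 : measurableType d1) (T2 : measurableType d2) (P : probability T1 R)
    (Z : T1 -> T2) (A : set T2) : measurable_fun setT Z -> measurable A ->
  P (Z @^-1` A) = (\int[P]_w (\1_A (Z w) : R)%:E)%E.
Proof.
move=> mZ mA; have m1A : measurable_fun setT (fun x => (\1_A x : R)%:E).
  exact/measurable_EFinP/measurable_indic.
rewrite -(integral_law P mZ m1A) => [|x]; last by rewrite lee_fin.
by rewrite integral_indic// setIT.
Qed.

Section wasserstein_contraction.
Context {R : realType} {d : nat} (hd : (0 < d)%N).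
Context (b : 'rV[R]_d -> 'rV[R]_d) (sigma : 'M[R]_d).
Context (b_C2 : C2 b) (b_D2 : bounded_second_derivatives b)
  (L : R) (L_gt0 : 0 < L) (b_lip : one_sided_lipschitz b L).
Context {dO : measure_display} {Omega : measurableType dO}.
Context (P : probability Omega R) (B : R -> Omega -> 'rV[R]_d).
Context (hB : standard_brownian_motion P B).
Context (p t : R) (p1 : 1 <= p) (t0 : 0 <= t).

Let cb : continuous b := drift_continuous b_C2.
Let p0 : 0 < p := lt_le_trans ltr01 p1.

Local Notation E := (borelE R d).
Local Notation Fl x w := (flow b sigma t (B ^~ w) x).
Local Notation K := (kappa P b sigma B p t).

(** The law at time t may be realized on any probability space; by uniqueness in
law its transition kernel can be computed with the given Brownian motion. *)
Lemma law_at_flow (nu nu' : probability E R) : law_at b sigma t nu nu' ->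
  forall A : set E, measurable A ->
  nu' A = (\int[nu]_x P ((fun w => Fl x w) @^-1` A))%E.
Proof.
case=> dO1 [] O1 [] P1 [] B1 [] X [] hB1 sX ind Xnu Xnu1 A mA.
have [mX _] := sX.
have mB1 s : 0 <= s -> random_vector (B1 s) := @brownian_measurable _ _ _ _ _ _ hB1 s.
have mN s : 0 <= s -> measurable_fun setT (B1 s : noise_space B1 `[0, +oo[ -> E).
  by move=> s0; apply: measurable_noise; rewrite /= in_itv/= s0.
have mid : measurable_fun setT ((fun w => w) : O1 -> noise_space B1 `[0, +oo[).
  by apply: measurable_noise_id => s; rewrite /= in_itv/= andbT; exact: mB1.
pose Z : O1 -> E := X 0.
have mZ : measurable_fun setT Z := mX 0 (lexx 0).
have mXt : measurable_fun setT (X t : O1 -> E) := mX t t0.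
have m1A : measurable_fun setT (fun x : E => (\1_A x : R)%:E).
  exact/measurable_EFinP/measurable_indic.
have pos (x : E) : (0 <= (\1_A x : R)%:E)%E by rewrite lee_fin.
pose f : E * noise_space B1 `[0, +oo[ -> \bar R :=
  fun q => (\1_A (flow b sigma t (B1 ^~ q.2) q.1) : R)%:E.
have mf : measurable_fun setT f.
  exact: (measurableT_comp m1A (measurable_flow sigma cb t0 mN)).
have f0 q : (0 <= f q)%E by exact: pos.
transitivity (\int[P1]_w (\1_A (X t w) : R)%:E)%E.
  by rewrite -(Xnu1 A mA) (probability_preimage P1 mXt mA).
transitivity (\int[P1]_w f (Z w, w))%E.
  apply: ge0_ae_eq_integral.
  - exact: measurableT.
  - exact: (measurableT_comp m1A mXt).
  - exact: (measurableT_comp mf (measurable_fun_pair mZ mid)).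
  - by move=> w _; exact: pos.
  - by move=> w _; exact: f0.
  - have XF := solution_flow b_C2 b_D2 hB1 sX.
    by apply: filterS XF => w Xw _; rewrite (Xw t t0).
rewrite (integral_freeze mZ mB1 ind mf f0).
rewrite (eq_measure_integral nu); last by move=> C mC _; exact: Xnu.
apply: eq_integral => x _.
have mF := measurable_flow_at sigma cb x t0 mB1.
rewrite (flow_law sigma b_C2 b_D2 L_gt0 b_lip hB hB1 x t0 mA).
exact/esym/(probability_preimage P1 mF mA).
Qed.

Let mBO s : 0 <= s -> random_vector (B s) := @brownian_measurable _ _ _ _ _ _ hB s.

(** The synchronous coupling: both components of a coupling of the initial laws
are moved by the same Brownian motion, independent of them. *)
Definition transport (pi : probability (E * E)%type R) : probability (E * E)%type R :=
  law (product_probability pi P) (measurable_pair_flow sigma b_C2 t0 mBO).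

Lemma transport_marginal (nu nu' : probability E R)
    (pi : probability (E * E)%type R) (pr : (E * E)%type -> E) :
  law_at b sigma t nu nu' -> measurable_fun setT pr ->
  (forall A : set E, measurable A -> pi (pr @^-1` A) = nu A) ->
  forall A : set E, measurable A ->
  (\int[pi]_z P ((fun w => Fl (pr z) w) @^-1` A))%E = nu' A.
Proof.
move=> Lnu mpr prE A mA; rewrite (law_at_flow Lnu mA).
pose h (x : E) : \bar R := P ((fun w => Fl x w) @^-1` A).
have mh : measurable_fun setT h.
  have mS := measurable_flow sigma cb t0 mBO measurableT mA; rewrite setTI in mS.
  have := measurable_fun_xsection P mS; congr (measurable_fun _ _).
  apply/funext => x; rewrite /h /=; congr (P _); apply/seteqP.
  by split => w; rewrite /xsection /= inE.
have h0 x : (0 <= h x)%E by exact: measure_ge0.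
transitivity (\int[law pi mpr]_x h x)%E.
  exact/esym/(integral_law pi mpr mh h0).
by apply: integral_eq_measure => C mC; exact: prE.
Qed.

Lemma transport_coupling (nu mu nu' mu' : probability E R) pi :
  law_at b sigma t nu nu' -> law_at b sigma t mu mu' -> coupling nu mu pi ->
  coupling nu' mu' (transport pi).
Proof.
move=> Lnu Lmu cpl A mA; split.
- rewrite -(@transport_marginal _ _ pi _ Lnu (@measurable_fst _ _ E E) _ A mA); last first.
    by move=> C mC; have [<- _] := cpl C mC; congr (pi _); apply/seteqP; split => z; [move=> ?; split|case].
  apply: eq_integral => z _; rewrite /=; congr (P _); apply/seteqP.
  by split => w; rewrite /xsection /= inE/=; [case|split].
- rewrite -(@transport_marginal _ _ pi _ Lmu (@measurable_snd _ _ E E) _ A mA); last first.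
    by move=> C mC; have [_ <-] := cpl C mC; congr (pi _); apply/seteqP; split => z; [move=> ?; split|case].
  apply: eq_integral => z _; rewrite /=; congr (P _); apply/seteqP.
  by split => w; rewrite /xsection /= inE/=; [case|split].
Qed.

Definition transport_cost (pi : probability (E * E)%type R) : \bar R :=
  (\int[pi]_z (enorm ((z.1 : 'rV[R]_d) - (z.2 : 'rV[R]_d))%R `^ p)%:E)%E.

Lemma transport_cost_ge0 pi : (0 <= transport_cost pi)%E.
Proof. by apply: integral_ge0 => z _; rewrite lee_fin powR_ge0. Qed.

Lemma transport_cost_le pi :
  (transport_cost (transport pi) <= K `^ p * transport_cost pi)%E.
Proof.
have D0 (z : (E * E)%type) :
    (0 <= (enorm ((z.1 : 'rV[R]_d) - (z.2 : 'rV[R]_d)) `^ p)%:E)%E.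
  by rewrite lee_fin powR_ge0.
have mD := @measurable_distance_pow R d p.
pose g : (E * E) * Omega -> \bar R :=
  fun q => (enorm (Fl q.1.1 q.2 - Fl q.1.2 q.2) `^ p)%:E.
have mg : measurable_fun setT g.
  exact: (measurableT_comp mD (measurable_pair_flow sigma b_C2 t0 mBO)).
have g0 q : (0 <= g q)%E by rewrite lee_fin powR_ge0.
have -> : transport_cost (transport pi) = (\int[product_probability pi P]_q g q)%E.
  exact: (integral_law _ _ mD D0).
rewrite /transport_cost (@fubini_tonelli1 _ _ _ _ _ pi P g mg g0).
rewrite -(ge0_integralZl _ measurableT mD (fun z _ => D0 z) (poweR_ge0 _ _)).
apply: ge0_le_integral.
- exact: measurableT.
- by move=> z _; apply: integral_ge0 => w _; exact: g0.
- exact: (@measurable_fun_fubini_tonelli_F _ _ _ _ _ P g mg g0).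
- by apply: measurable_funeM; exact: mD.
- move=> [x y] _; exact: (moment_flow_gap hd sigma b_C2 b_D2 L_gt0 b_lip hB p1 t0 x y).
Qed.

(** Synchronous transport of couplings bounds the infimum of the costs. The ratio
also has to be bounded in the degenerate cases, where the convention for the
inverse gives 0 as the inverse of +oo and +oo as the inverse of 0. *)
Lemma wasserstein_contraction (nu mu nu' mu' : probability E R) :
  law_at b sigma t nu nu' -> law_at b sigma t mu mu' ->
  (wasserstein p nu' mu' / wasserstein p nu mu <= K)%E.
Proof.
move=> Lnu Lmu; rewrite /wasserstein.
set S' := [set _ | _]; set S := [set _ | _].
have K0 : (0 <= K)%E := kappa_ge0 hd sigma b_C2 b_D2 L_gt0 b_lip hB p t.
have Kfin : K \is a fin_num := kappa_fin_num hd sigma b_C2 b_D2 L_gt0 b_lip hB p1 t0.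
have S0 : (0 <= ereal_inf S)%E.
  by apply: le_ereal_inf_tmp => _ [pi _ ->]; exact: transport_cost_ge0.
have S'0 : (0 <= ereal_inf S')%E.
  by apply: le_ereal_inf_tmp => _ [pi _ ->]; exact: transport_cost_ge0.
have step pi : coupling nu mu pi -> (ereal_inf S' <= K `^ p * transport_cost pi)%E.
  move=> cpl; apply: le_trans (transport_cost_le pi).
  apply: ereal_inf_lbound; exists (transport pi) => //.
  exact: transport_coupling Lnu Lmu cpl.
have [Soo|Sfin] := eqVneq (ereal_inf S) +oo%E.
  by rewrite Soo poweRyr ?invr_eq0 ?gt_eqF// invey mule0.
have {}Sfin : ereal_inf S \is a fin_num by rewrite ge0_fin_numE// lt_neqAle Sfin leey.
have Kp0 : (0 <= K `^ p)%E by exact: poweR_ge0.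
have Kpfin : (K `^ p)%E \is a fin_num.
  by rewrite ge0_fin_numE// poweR_lty// ltey_eq Kfin.
have SS' : (ereal_inf S' <= K `^ p * ereal_inf S)%E.
  (* If kappa vanishes, one coupling is enough, and the finite infimum provides one. *)
  have [Kp_eq0|Kp_neq0] := eqVneq (K `^ p)%E 0%E.
    have [_ [pi cpl _] _] : exists2 r, S r & (r < +oo)%E.
      by apply: ereal_inf_lt; rewrite ltey_eq Sfin.
    by have := step pi cpl; rewrite Kp_eq0 !mul0e.
  have kp : 0 < fine (K `^ p)%E by rewrite fine_gt0// lt_neqAle eq_sym Kp_neq0 Kp0 ltey_eq Kpfin.
  rewrite -(fineK Kpfin) -lee_pdivrMl//; apply: le_ereal_inf_tmp => _ [pi cpl ->].
  by rewrite lee_pdivrMl// fineK//; exact: step.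
have W : (ereal_inf S' `^ p^-1 <= K * ereal_inf S `^ p^-1)%E.
  rewrite (_ : K = ((K `^ p) `^ p^-1)%E); last first.
    by rewrite -poweRrM mulfV ?gt_eqF// poweRe1.
  rewrite -poweRM//; apply: gt0_ler_poweR => //; first by rewrite invr_ge0 ltW.
    by rewrite in_itv/= leey andbT.
  by rewrite in_itv/= leey andbT mule_ge0.
have WS0 : (0 <= ereal_inf S `^ p^-1)%E by exact: poweR_ge0.
have WS'0 : (0 <= ereal_inf S' `^ p^-1)%E by exact: poweR_ge0.
have WSfin : (ereal_inf S `^ p^-1)%E \is a fin_num.
  by rewrite ge0_fin_numE// poweR_lty// ltey_eq Sfin.
(* If the initial distance is 0, so is the final one, and 0 * +oo = 0. *)
have [W0|Wn0] := eqVneq (ereal_inf S `^ p^-1)%E 0%E.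
  move: W; rewrite W0 mule0 => W.
  have -> : (ereal_inf S' `^ p^-1 = 0)%E by apply/eqP; rewrite eq_le W WS'0.
  by rewrite mul0e.
have w0 : 0 < fine (ereal_inf S `^ p^-1)%E by rewrite fine_gt0// lt_neqAle eq_sym Wn0 WS0 ltey_eq WSfin.
move: W; rewrite -(fineK WSfin) inver gt_eqF// => W.
by rewrite lee_pdivrMr.
Qed.

Lemma beta_le_kappa : (beta b sigma p t <= K)%E.
Proof.
apply: ub_ereal_sup => _ [nu [mu [nu' [mu' [_ _ Lnu Lmu ->]]]]].
exact: wasserstein_contraction.
Qed.

End wasserstein_contraction.

(** * The coupling characterization and its consequences *)

Theorem proposition1 (R : realType) (d : nat) (hd : (0 < d)%N)
    (sigma : 'M[R]_d) (b : 'rV[R]_d -> 'rV[R]_d)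
    (b_C2 : C2 b) (b_D2 : bounded_second_derivatives b)
    (b_lip : exists2 L : R, 0 < L & one_sided_lipschitz b L)
    (dO : measure_display) (Omega : measurableType dO)
    (P : probability Omega R) (B : R -> Omega -> 'rV[R]_d)
    (hB : standard_brownian_motion P B) :
  [/\ (forall p t : R, 1 <= p -> 0 <= t ->
         (kappa P b sigma B p t `^ p = coupling_sup P b sigma B p t)%E),
      (forall p t : R, 1 <= p -> 0 <= t ->
         forall X Y : R -> Omega -> 'rV[R]_d,
         sde_solution P b sigma B X -> sde_solution P b sigma B Y ->
         independent_of_process P
           ((fun w => (X 0 w, Y 0 w)) : Omega -> (borelE R d * borelE R d)%type)
           B ->
         (moment P p (fun w => (X t w - Y t w)%R)
          <= kappa P b sigma B p t `^ p
             * moment P p (fun w => (X 0 w - Y 0 w)%R))%E) &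
      (forall p t : R, 1 <= p -> 0 <= t ->
         (beta b sigma p t <= kappa P b sigma B p t)%E)].
Proof.
have [L L_gt0 Lb] := b_lip; split=> p t p1 t0.
- exact: (kappa_coupling_sup hd sigma b_C2 b_D2 L_gt0 Lb hB p1 t0).
- move=> X Y sX sY ind.
  exact: (coupling_moment hd b_C2 b_D2 L_gt0 Lb hB p1 t0 sX sY ind).
- exact: (beta_le_kappa hd sigma b_C2 b_D2 L_gt0 Lb hB p1 t0).
Qed.
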